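(* \textsc{Locating-Dominating Set} can be solved by an algorithm running in time $2^{\mathcal{O}(\mathsf{vc}\log\mathsf{vc})}\cdot n^{\mathcal{O}(1)}$, where $n$ is the number of vertices and $\mathsf{vc}$ is the vertex cover number of the input graph. Moreover, \textsc{Test Cover} can be solved by an algorithm running in time $2^{\mathcal{O}(|U|\log|U|)}\cdot(|U|+|\mathcal{F}|)^{\mathcal{O}(1)}$.
   Context: All graphs are finite, simple and undirected; $N(u)$ denotes the open neighbourhood of $u$. A set $S\subseteq V(G)$ is a locating-dominating set of $G$ if $S$ is a dominating set of $G$ and for any two distinct vertices $u,v\in V(G)\setminus S$ we have $N(u)\cap S\neq N(v)\cap S$. \textsc{Locating-Dominating Set}: given a graph $G$ and an integer $k$, decide whether $G$ has a locating-dominating set of size at most $k$. \textsc{Test Cover}: given a finite set $U$ of items, a collection $\mathcal{F}$ of subsets of $U$ (tests) and an integer $k$, decide whether there is a subcollection of at most $k$ tests such that for every pair of distinct items some chosen test contains exactly one of the two items. The vertex cover number $\mathsf{vc}$ of $G$ is the minimum size of a set of vertices meeting every edge. *)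

(* Defs.v *)
(* Mathematical Components *)
From mathcomp Require Import all_boot all_order ssralg ssrnum ssrint.

Set Implicit Arguments.
Unset Strict Implicit.
Unset Printing Implicit Defensive.

(** * Model of computation

  Algorithms are programs of a first-order, call-by-value functional language
  whose only values are binary trees.  A program is a fixed finite list of
  (possibly mutually recursive) one-argument functions, function 0 being the
  entry point.  Variables are de Bruijn indices: [Let] binds one variable,
  [Case] binds the two subtrees of a node (left = 0, right = 1), and in the
  body of a function the argument is variable 0.

  The time of a run is the number of rules in its evaluation derivation.  No
  rule copies, compares or otherwise traverses a tree, and environments have a
  length bounded by the size of the program; with trees represented by
  pointers, every rule is therefore a constant number (depending only on the
  program) of RAM steps.  Conversely a Turing machine, its tape being a pair
  of lists, is simulated with constant overhead per step.  Hence time in this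
  model agrees with Turing machine or RAM time up to a polynomial. *)

Inductive tree : Type := Leaf | Node of tree & tree.

Inductive exp : Type :=
| Var of nat
| Nil
| Cons of exp & exp
| Case of exp & exp & exp
| Let of exp & exp
| Call of nat & exp.

Definition program := seq exp.

Definition body (P : program) (f : nat) : exp := nth Nil P f.

(* [eval P env e v t]: in the environment [env], [e] terminates with value [v]
   in time exactly [t]. *)
Inductive eval (P : program) : seq tree -> exp -> tree -> nat -> Prop :=
| EvalVar env i : eval P env (Var i) (nth Leaf env i) 1
| EvalNil env : eval P env Nil Leaf 1
| EvalCons env e1 e2 v1 v2 t1 t2 :
    eval P env e1 v1 t1 -> eval P env e2 v2 t2 ->
    eval P env (Cons e1 e2) (Node v1 v2) (t1 + t2).+1
| EvalCaseLeaf env e e1 e2 v t t1 :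
    eval P env e Leaf t -> eval P env e1 v t1 ->
    eval P env (Case e e1 e2) v (t + t1).+1
| EvalCaseNode env e e1 e2 a b v t t2 :
    eval P env e (Node a b) t -> eval P [:: a, b & env] e2 v t2 ->
    eval P env (Case e e1 e2) v (t + t2).+1
| EvalLet env e1 e2 v1 v t1 t2 :
    eval P env e1 v1 t1 -> eval P (v1 :: env) e2 v t2 ->
    eval P env (Let e1 e2) v (t1 + t2).+1
| EvalCall env f e v1 v t1 t2 :
    eval P env e v1 t1 -> eval P [:: v1] (body P f) v t2 ->
    eval P env (Call f e) v (t1 + t2).+1.

Lemma eval_det P env e v t v' t' :
  eval P env e v t -> eval P env e v' t' -> v = v' /\ t = t'.
Proof.
move=> ev; elim: ev v' t' => {env e v t}
  [env i|env|env e1 e2 v1 v2 t1 t2 _ IH1 _ IH2|env e e1 e2 v t t1 _ IH1 _ IH2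
  |env e e1 e2 a b v t t2 _ IH1 _ IH2|env e1 e2 v1 v t1 t2 _ IH1 _ IH2
  |env f e v1 v t1 t2 _ IH1 _ IH2] v' t' ev'; inversion ev'; subst => //;
  match goal with ev : eval _ _ _ _ _ |- _ =>
    case: (IH1 _ _ ev) => // eq1 ->; inversion eq1; subst end;
  by match goal with ev : eval _ _ _ v' _ |- _ => case: (IH2 _ _ ev) => -> ->
               | ev : eval _ _ _ _ _ |- _ => case: (IH2 _ _ ev) => -> -> end.
Qed.

Definition code_bool (b : bool) : tree := if b then Node Leaf Leaf else Leaf.

Definition code_seq (s : seq tree) : tree := foldr Node Leaf s.

(* Binary, least significant bit first, without leading zeros. *)
Definition code_nat (n : nat) : tree :=
  code_seq (mkseq (fun i => code_bool (odd (n %/ 2 ^ i))) (up_log 2 n.+1)).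

Definition code_int (z : int) : tree :=
  Node (code_bool (z < 0)%R) (code_nat `|z|%N).

(* The decision problem with instances [I], encoded by [code], and yes-instances
   [yes] is solved by one program in time 2^O(f x) * (size x)^O(1) on every
   instance [x].  The factor [c] and the successor absorb the finitely many
   degenerate values of the parameters (such as the empty graph) at which f x or
   size x vanishes although no run takes time 0. *)
Definition solvable_in_time (I : Type) (code : I -> tree) (yes : I -> bool)
    (f size : I -> nat) : Prop :=
  exists (P : program) (c : nat), forall x : I, exists2 t : nat,
    eval P [:: code x] (body P 0) (code_bool (yes x)) t
    & t <= c * 2 ^ (c * f x) * (size x).+1 ^ c.

(* x log x; rounding the binary logarithm down only changes the constant hidden
   by the O-notation, and 0 log 0 = 0. *)
Definition nlogn (x : nat) : nat := x * trunc_log 2 x.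

(** * Graphs *)

Record sgraph := SGraph {
  nverts : nat;
  adj : rel 'I_nverts;
  adj_sym : symmetric adj;
  adj_irr : irreflexive adj
}.

Section Graph.
Variable G : sgraph.
Implicit Types (u v : 'I_(nverts G)) (S C : {set 'I_(nverts G)}).

Definition nbh u : {set 'I_(nverts G)} := [set v | adj u v].

Definition dominating S : bool :=
  [forall u, (u \in S) || [exists v in S, adj u v]].

Definition locating_dominating S : bool :=
  dominating S &&
  [forall u, forall v, [&& u \notin S, v \notin S & u != v] ==>
                       (nbh u :&: S != nbh v :&: S)].

Definition vertex_cover C : bool :=
  [forall u, forall v, adj u v ==> (u \in C) || (v \in C)].

Definition vc : nat :=
  #|[arg min_(C < [set: 'I_(nverts G)] | vertex_cover C) #|C| ]|.

(* Adjacency matrix, row by row. *)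
Definition code_graph : tree :=
  code_seq [seq code_seq [seq code_bool (adj u v) | v <- enum 'I_(nverts G)]
           | u <- enum 'I_(nverts G)].

End Graph.

Record lds_instance := LdsInstance { lds_graph : sgraph; lds_budget : int }.

Definition code_lds (x : lds_instance) : tree :=
  Node (code_graph (lds_graph x)) (code_int (lds_budget x)).

Definition lds (x : lds_instance) : bool :=
  [exists S : {set 'I_(nverts (lds_graph x))},
    locating_dominating S && (#|S|%:Z <= lds_budget x)%R].

(** * Test Cover *)

(* The items are 0, ..., items - 1.  The collection of tests is given by an
   arbitrary duplicate-free listing, so that |F| = size tests. *)
Record tc_instance := TcInstance {
  items : nat;
  tests : seq {set 'I_items};
  tests_uniq : uniq tests;
  tc_budget : int
}.

Definition test_cover (n : nat) (C : {set {set 'I_n}}) : bool :=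
  [forall x, forall y, (x != y) ==> [exists T in C, (x \in T) (+) (y \in T)]].

(* The number of items in unary, the tests as characteristic vectors, and k. *)
Definition code_tc (x : tc_instance) : tree :=
  Node (code_seq (nseq (items x) Leaf))
    (Node (code_seq [seq code_seq [seq code_bool (i \in T) | i <- enum 'I_(items x)]
                    | T : {set _} <- tests x])
          (code_int (tc_budget x))).

Definition tc (x : tc_instance) : bool :=
  [exists C : {set {set 'I_(items x)}},
    [&& C \subset tests x, test_cover C & (#|C|%:Z <= tc_budget x)%R]].

(* Main.v *)
Require Import Defs.
From mathcomp Require Import all_boot all_order ssralg ssrnum ssrint zify.

(* Both problems reduce to the following one: given tests on k items and a list
   of groups of test sets, pick one test set in each group so that the union
   separates prescribed pairs of items and is small.  Process the groups in
   order, keeping the set of all reachable pairs (number of tests picked, set of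
   pairs of items already separated).  The pairs that are not separated form an
   equivalence relation, so at most k^k times the number of sizes occur.

   For Test Cover each test is a group: skip it or take it.

   For Locating-Dominating Set let U be the ends of a maximal matching, so that
   |U| <= 2 vc and the complement R is independent.  Guess Y = S n U and the set Z
   of vertices of U with a neighbour in S \ U.  Two vertices of R outside S can
   only be told apart by Y, so each class of R for the neighbourhoods in Y has at
   most one member outside S; the classes are the groups.  A vertex w of R outside
   S has to be dominated by Y and, as S \ U does not see w, told apart by Y from
   every vertex of U \ (Y u Z); knowing Z this does not involve S \ U.  The
   items are the vertices of U and one isolated vertex, separation from which is
   domination.

   Programs are obtained from closure properties of the functions computable in
   polynomial time, all loops being folds over lists. *)

Set Implicit Arguments.
Unset Strict Implicit.
Unset Printing Implicit Defensive.

(** * Polynomial-time programs *)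

(** A vertex [w] of R left out of S has no neighbour in R, so a vertex of S \ U tells [w] apart from
    [u] in U exactly when it is adjacent to [u]. It therefore matters whether [u] is dominated from
    outside U, but not by which vertex: guessing Z turns all requirements on R into conditions on
    single classes, and only pairs inside U and the extra item couple the classes. There are 4^|U|
    guesses of Y and Z. The exponent k log k comes from counting states as kernels of maps on k
    items; arbitrary sets of pairs would give 2^(k^2). The measure of the time bounds contains the
    factor 2^(x log x), so the exponentially long loops over guesses and states count as polynomial.
    The budget is written in binary and its length is not part of the instance size, so a program
    may not read all of it. No solution exceeds the number of vertices or tests, and the budget is
    replaced by its minimum with that number. *)

Fixpoint ren (r : nat -> nat) (e : exp) : exp :=
  match e with
  | Var i => Var i
  | Defs.Nil => Defs.Nil
  | Defs.Cons a b => Defs.Cons (ren r a) (ren r b)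
  | Case a b c => Case (ren r a) (ren r b) (ren r c)
  | Let a b => Let (ren r a) (ren r b)
  | Call f a => Call (r f) (ren r a)
  end.

Lemma eval_ren P R r env e v t : (forall f, body R (r f) = ren r (body P f)) ->
  eval P env e v t -> eval R env (ren r e) v t.
Proof.
move=> hr; elim=> {env e v t} /=; try by econstructor; eauto.
by move=> *; econstructor; eauto; rewrite hr.
Qed.

(** A new entry point [M] calling two existing programs: their functions are stored one after the
    other behind it and their calls are shifted. Run times are unchanged. *)
Lemma link (M : nat -> nat -> exp) (P Q : program) : exists R p q,
  [/\ body R 0 = M p q,
   forall v w t, eval P [:: v] (body P 0) w t -> eval R [:: v] (body R p) w t &
   forall v w t, eval Q [:: v] (body Q 0) w t -> eval R [:: v] (body R q) w t].
Proof.
(* A call beyond the end of a program runs the default body [Nil]. It is redirected to the length of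
   [R], which is again out of range. *)
pose rP f := if f < size P then f.+1 else (size P + size Q).+1.
pose rQ f := if f < size Q then (size P + f).+1 else (size P + size Q).+1.
pose R := M (rP 0) (rQ 0) :: map (ren rP) P ++ map (ren rQ) Q.
have hP f : body R (rP f) = ren rP (body P f).
  rewrite /body /rP; case: ltnP => hf /=.
    by rewrite nth_cat size_map hf (nth_map Defs.Nil).
  by rewrite !nth_default // size_cat !size_map.
have hQ f : body R (rQ f) = ren rQ (body Q f).
  rewrite /body /rQ; case: ltnP => hf /=.
    by rewrite nth_cat size_map ltnNge leq_addr addKn /= (nth_map Defs.Nil).
  by rewrite !nth_default // size_cat !size_map.
exists R, (rP 0), (rQ 0); split=> // v w t ev; rewrite ?hP ?hQ; exact: eval_ren ev.
Qed.

Ltac eval_var :=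
  match goal with |- eval ?P ?env (Var ?i) _ _ => exact (EvalVar P env i) end.
Ltac case_node := eapply EvalCaseNode; [eval_var | ].
Ltac case_leaf := eapply EvalCaseLeaf; [eval_var | ].

Class code (A : Type) := enc : A -> tree.
#[local] Instance code_bool' : code bool := code_bool.
#[local] Instance code_unit : code unit := fun _ => Leaf.
(** Unary numbers have the same code as lists of units, so loops over numbers are folds over lists.
    Only the budget is kept in binary, as a list of bits. *)
#[local] Instance code_unary : code nat := fun n => code_seq (nseq n Leaf).
#[local] Instance code_list A {cA : code A} : code (seq A) := fun s => code_seq (map enc s).
#[local] Instance code_prod A B {cA : code A} {cB : code B} : code (A * B) :=
  fun p => Node (enc p.1) (enc p.2).

Definition pb (I : Type) (D : I -> Prop) (m F : I -> nat) :=
  exists c, forall i, D i -> F i <= c * (m i).+1 ^ c.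

(* The measure [m] need not be related to the size of the input: in the body of a
   loop the input contains the loop variables, but the time is still measured in
   terms of the original instance.  Likewise [D] carries the loop invariants. *)
Definition pc (I A : Type) {cI : code I} {cA : code A}
    (D : I -> Prop) (m : I -> nat) (F : I -> A) :=
  exists (P : program) (c : nat), forall i, D i -> exists2 t,
    eval P [:: enc i] (body P 0) (enc (F i)) t & t <= c * (m i).+1 ^ c.

Section PolyBound.
Variables (I : Type) (D : I -> Prop) (m : I -> nat).

Lemma pb_const k : pb D m (fun _ => k).
Proof. by exists k => i _; rewrite leq_pmulr // expn_gt0. Qed.

Lemma pb_m : pb D m m.
Proof. by exists 1 => i _; rewrite mul1n expn1. Qed.

Lemma pb_le F G : pb D m G -> (forall i, D i -> F i <= G i) -> pb D m F.
Proof. by move=> [c hc] h; exists c => i Di; apply: leq_trans (h i Di) (hc i Di). Qed.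

Lemma pb_add F G : pb D m F -> pb D m G -> pb D m (fun i => F i + G i).
Proof.
move=> [c hc] [d hd]; exists (c + d) => i Di; rewrite mulnDl leq_add //.
  by apply: leq_trans (hc i Di) _; rewrite leq_mul // leq_pexp2l // leq_addr.
by apply: leq_trans (hd i Di) _; rewrite leq_mul // leq_pexp2l // leq_addl.
Qed.

Lemma pb_mul F G : pb D m F -> pb D m G -> pb D m (fun i => F i * G i).
Proof.
move=> [c hc] [d hd]; exists (c * d + c + d) => i Di.
apply: leq_trans (leq_mul (hc i Di) (hd i Di)) _.
rewrite mulnACA -expnD leq_mul // ?leq_pexp2l //; lia.
Qed.

Lemma pb_exp F k : pb D m F -> pb D m (fun i => F i ^ k).
Proof.
move=> hF; elim: k => [|k IH]; first exact: (pb_const 1).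
by apply: pb_le (pb_mul hF IH) _ => i _; rewrite expnS.
Qed.

End PolyBound.

Lemma pb_comp I J (D : I -> Prop) (m : I -> nat) (D' : J -> Prop) (m' : J -> nat)
    (F : J -> nat) (g : I -> J) :
  pb D' m' F -> (forall i, D i -> D' (g i)) -> pb D m (fun i => m' (g i)) ->
  pb D m (fun i => F (g i)).
Proof.
move=> [c hc] hD hm; have [d hd] := pb_mul (pb_const D m c) (pb_exp c (pb_add hm (pb_const D m 1))).
exists d => i Di; apply: leq_trans (hc _ (hD _ Di)) _.
by apply: leq_trans (hd i Di); rewrite addn1.
Qed.

Section Pc.
Context (I : Type) {cI : code I}.
Variables (D : I -> Prop) (m : I -> nat).

Lemma pcT A (cA : code A) (F : I -> A) (P : program) (T : I -> nat) :
  pb D m T ->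
  (forall i, D i -> exists2 t, eval P [:: enc i] (body P 0) (enc (F i)) t & t <= T i) ->
  pc D m F.
Proof.
move=> [c hc] h; exists P, c => i Di; case: (h i Di) => t ev le.
by exists t => //; apply: leq_trans le (hc i Di).
Qed.

Lemma pc_ext A (cA : code A) (F G : I -> A) :
  pc D m F -> (forall i, D i -> F i = G i) -> pc D m G.
Proof. by move=> [P [c h]] e; exists P, c => i Di; rewrite -e //; apply: h. Qed.

(* Any two codes are allowed, so that a value can be read at another type. *)
Lemma pc_cast A B (cA : code A) (cB : code B) (F : I -> A) (G : I -> B) :
  pc D m F -> (forall i, D i -> enc (F i) = enc (G i)) -> pc D m G.
Proof. by move=> [P [c h]] e; exists P, c => i Di; rewrite -e //; apply: h. Qed.

Lemma pc_id : pc D m id.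
Proof.
apply: (@pcT _ _ _ [:: Var 0] (fun=> 1)); first exact: pb_const.
by move=> i _; exists 1 => //; apply: EvalVar.
Qed.

Lemma pc_leaf A (cA : code A) (a : A) : enc a = Leaf -> pc D m (fun _ => a).
Proof.
move=> ea; apply: (@pcT _ _ _ [:: Defs.Nil] (fun=> 1)); first exact: pb_const.
by move=> i _; exists 1; rewrite // ea; apply: EvalNil.
Qed.

Lemma pc_node A B C (cA : code A) (cB : code B) (cC : code C)
    (F : I -> A) (G : I -> B) (H : I -> C) :
  (forall i, enc (H i) = Node (enc (F i)) (enc (G i))) ->
  pc D m F -> pc D m G -> pc D m H.
Proof.
move=> e [P [c hP]] [Q [d hQ]].
have [R [p [q [eR hp hq]]]] :=
  link (fun p q => Defs.Cons (Call p (Var 0)) (Call q (Var 0))) P Q.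
apply: (@pcT _ _ _ R (fun i => c * (m i).+1 ^ c + d * (m i).+1 ^ d + 5)).
  by apply: pb_add (pb_const _ _ _); apply: pb_add; [exists c|exists d].
move=> i Di; case: (hP i Di) => t ev le; case: (hQ i Di) => u ev' le'.
exists ((1 + t).+1 + (1 + u).+1).+1; last lia.
rewrite eR e; apply: EvalCons; apply: EvalCall (EvalVar _ _ 0) _ => /=; auto.
Qed.

End Pc.

Lemma pc_comp I J A (cI : code I) (cJ : code J) (cA : code A)
   (D : I -> Prop) m (D' : J -> Prop) m' (g : I -> J) (F : J -> A) :
  pc D' m' F -> pc D m g -> (forall i, D i -> D' (g i)) ->
  pb D m (fun i => m' (g i)) -> pc D m (fun i => F (g i)).
Proof.
move=> [P [c hP]] [Q [d hQ]] hD hm.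
have [R [p [q [eR hp hq]]]] := link (fun p q => Call p (Call q (Var 0))) P Q.
apply: (@pcT _ _ _ _ _ _ _ R (fun i => d * (m i).+1 ^ d + c * (m' (g i)).+1 ^ c + 5)).
  apply: pb_add (pb_const _ _ _); apply: pb_add; first by exists d.
  apply: (@pb_comp _ _ _ _ D' m' (fun j => c * (m' j).+1 ^ c) g) => //.
  by exists c.
move=> i Di; case: (hP (g i) (hD i Di)) => t ev le; case: (hQ i Di) => u ev' le'.
exists ((1 + u).+1 + t).+1; last lia.
rewrite eR; exact: EvalCall (EvalCall (EvalVar R [:: enc i] 0) (hq _ _ _ ev')) (hp _ _ _ ev).
Qed.

Section Pc2.
Context (I : Type) {cI : code I}.
Variables (D : I -> Prop) (m : I -> nat).

Lemma pc_pair A B (cA : code A) (cB : code B) (F : I -> A) (G : I -> B) :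
  pc D m F -> pc D m G -> pc D m (fun i => (F i, G i)).
Proof. exact: pc_node. Qed.

(** Branching on whether a code is [Leaf] treats [false], the empty list and zero alike. Each branch
    may use the outcome of the test as an additional fact on its inputs. *)
Lemma pc_case A B (cA : code A) (cB : code B) (b : I -> A) (F : I -> B) :
  pc D m b ->
  pc (fun i => D i /\ enc (b i) = Leaf) m F ->
  pc (fun i => D i /\ enc (b i) <> Leaf) m F ->
  pc D m F.
Proof.
move=> [B' [b' hb]] [P [c hP]] [Q [d hQ]].
(* [Var 1] and [Var 3] both denote the original input: the inner [Case] binds two more variables in
   its node branch. *)
have [R0 [p0 [q0 [eR0 hp0 hq0]]]] :=
  link (fun p q => Case (Var 0) Defs.Nil (Case (Var 0) (Call p (Var 1))
          (Call q (Var 3)))) P Q.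
have [R [p [q [eR hp hq]]]] :=
  link (fun p q => Call p (Defs.Cons (Call q (Var 0)) (Var 0))) R0 B'.
apply: (@pcT _ _ _ _ _ _ _ R (fun i => b' * (m i).+1 ^ b' + c * (m i).+1 ^ c + d * (m i).+1 ^ d + 20)).
  apply: pb_add (pb_const _ _ _); apply: pb_add; last by exists d.
  by apply: pb_add; [exists b' | exists c].
move=> i Di; case: (hb i Di) => t ev le.
have [u ev' le'] : exists2 u, eval R0 [:: Node (enc (b i)) (enc i)] (body R0 0) (enc (F i)) u
   & u <= c * (m i).+1 ^ c + d * (m i).+1 ^ d + 10.
  rewrite eR0; case eb: (enc (b i)) => [|x y].
    case: (hP i) => // u evu leu.
    exists (1 + (1 + (1 + u).+1).+1).+1; last lia.
    case_node; case_leaf.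
    by eapply EvalCall; [eval_var | exact: hp0 evu].
  case: (hQ i) => [|u evu leu]; first by rewrite eb.
  exists (1 + (1 + (1 + u).+1).+1).+1; last lia.
  case_node; case_node.
  by eapply EvalCall; [eval_var | exact: hq0 evu].
exists (((1 + t).+1 + 1).+1 + u).+1; last lia.
rewrite eR; eapply EvalCall; last exact: hp ev'.
apply: EvalCons; last eval_var.
by eapply EvalCall; [eval_var | exact: hq ev].
Qed.

End Pc2.

Lemma pc_projl I A B C (cI : code I) (cA : code A) (cB : code B) (cC : code C)
   (D : I -> Prop) m (F : I -> A) (x : I -> B) (y : I -> C) :
  (forall i, D i -> enc (F i) = Node (enc (x i)) (enc (y i))) ->
  pc D m F -> pc D m x.
Proof.
move=> e [P [c hP]].
have [R [p [q [eR hp hq]]]] :=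
  link (fun p q => Case (Call p (Var 0)) Defs.Nil (Var 0)) P P.
apply: (@pcT _ _ _ _ _ _ _ R (fun i => c * (m i).+1 ^ c + 5)).
  by apply: pb_add (pb_const _ _ _); exists c.
move=> i Di; case: (hP i Di) => t; rewrite e // => ev le.
exists ((1 + t).+1 + 1).+1; last lia.
rewrite eR; eapply EvalCaseNode; last by eval_var.
by eapply EvalCall; [eval_var | exact: hp ev].
Qed.

Lemma pc_projr I A B C (cI : code I) (cA : code A) (cB : code B) (cC : code C)
   (D : I -> Prop) m (F : I -> A) (x : I -> B) (y : I -> C) :
  (forall i, D i -> enc (F i) = Node (enc (x i)) (enc (y i))) ->
  pc D m F -> pc D m y.
Proof.
move=> e [P [c hP]].
have [R [p [q [eR hp hq]]]] :=
  link (fun p q => Case (Call p (Var 0)) Defs.Nil (Var 1)) P P.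
apply: (@pcT _ _ _ _ _ _ _ R (fun i => c * (m i).+1 ^ c + 5)).
  by apply: pb_add (pb_const _ _ _); exists c.
move=> i Di; case: (hP i Di) => t; rewrite e // => ev le.
exists ((1 + t).+1 + 1).+1; last lia.
rewrite eR; eapply EvalCaseNode; last by eval_var.
by eapply EvalCall; [eval_var | exact: hp ev].
Qed.

(** The step only has to be fast on states that occur, namely folds over a prefix of the list. All
    loop invariants used later enter through this restriction, and the measure stays that of the
    loop-invariant input [i]. *)
Lemma pc_foldl_core I S A (cI : code I) (cS : code S) (cA : code A)
    (D : I -> Prop) m (f : I -> S -> A -> S) (s0 : I -> S) (l : I -> seq A) :
  pb D m (fun i => size (l i)) ->
  pc (fun q : I * S * A => D q.1.1 /\ exists l1 l2,
        l q.1.1 = l1 ++ q.2 :: l2 /\ q.1.2 = foldl (f q.1.1) (s0 q.1.1) l1)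
     (fun q => m q.1.1) (fun q => f q.1.1 q.1.2 q.2) ->
  exists P c, forall i, D i -> exists2 t,
    eval P [:: enc (i, s0 i, l i)] (body P 0) (enc (foldl (f i) (s0 i) (l i))) t
    & t <= c * (m i).+1 ^ c.
Proof.
move=> hs [P [c hP]].
(* Function 0 calls itself on the triple of [i], the state and the remaining list; with an empty
   list it returns the state. *)
have [R [p [_ [eR hp _]]]] := link (fun p _ =>
  Case (Var 0) Defs.Nil (Case (Var 1) (Case (Var 0) Defs.Nil (Var 1))
    (Case (Var 2) Defs.Nil (Call 0 (Defs.Cons (Defs.Cons (Var 0)
        (Call p (Defs.Cons (Defs.Cons (Var 0) (Var 1)) (Var 2)))) (Var 3)))))) P P.
have [d hd] : pb D m (fun i => (size (l i)).+1 * (c * (m i).+1 ^ c + 20)).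
  apply: pb_mul; first by apply: pb_le (pb_add hs (pb_const _ _ 1)) _ => i _; rewrite addn1.
  by apply: pb_add (pb_const _ _ _); exists c.
exists R, d => i Di.
(* Induction on the remaining suffix; the summand 20 pays for the evaluation rules of one iteration
   besides the step itself. *)
enough (H : forall l1 l2, l i = l1 ++ l2 -> exists2 t,
    eval R [:: enc (i, foldl (f i) (s0 i) l1, l2)] (body R 0) (enc (foldl (f i) (s0 i) (l i))) t
    & t <= (size l2).+1 * (c * (m i).+1 ^ c + 20)).
  by case: (H [::] (l i) erefl) => t ev le; exists t => //; apply: leq_trans (hd _ Di).
move=> l1 l2; elim: l2 l1 => [|a l2 IH] l1 el; rewrite eR.
  exists (1 + (1 + (1 + 1).+1).+1).+1; last lia.
  case_node; case_leaf.
  rewrite el cats0.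
  by case_node; eval_var.
case: (IH (rcons l1 a)) => [|t ev le]; first by rewrite cat_rcons.
case: (hP (i, foldl (f i) (s0 i) l1, a)) => [|u evu leu]; first by split=> //; exists l1, l2.
rewrite foldl_rcons in ev; move: leu => /= leu.
exists (1 + (1 + (1 + (((1 + (((1 + 1).+1 + 1).+1 + u).+1).+1 + 1).+1 + t).+1).+1).+1).+1; last first.
  by rewrite mulSn; lia.
case_node; case_node.
case_node; eapply EvalCall; last exact: ev.
apply: EvalCons; last by eval_var.
apply: EvalCons; first by eval_var.
eapply EvalCall; last exact: hp evu.
apply: EvalCons; last by eval_var.
by apply: EvalCons; [eval_var|eval_var].
Qed.

Lemma pc_mono I A (cI : code I) (cA : code A) (D D' : I -> Prop) m (F : I -> A) :
  pc D' m F -> (forall i, D i -> D' i) -> pc D m F.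
Proof. by move=> [P [c h]] hD; exists P, c => i /hD; apply: h. Qed.

Lemma pc_foldl I S A (cI : code I) (cS : code S) (cA : code A)
    (D : I -> Prop) m (f : I -> S -> A -> S) (s0 : I -> S) (l : I -> seq A) :
  pc D m s0 -> pc D m l -> pb D m (fun i => size (l i)) ->
  pc (fun q : I * S * A => D q.1.1 /\ exists l1 l2,
        l q.1.1 = l1 ++ q.2 :: l2 /\ q.1.2 = foldl (f q.1.1) (s0 q.1.1) l1)
     (fun q => m q.1.1) (fun q => f q.1.1 q.1.2 q.2) ->
  pc D m (fun i => foldl (f i) (s0 i) (l i)).
Proof.
move=> h0 hl hs hf; have [P [c hP]] := pc_foldl_core hs hf.
apply: (@pc_comp _ (I * S * seq A) _ _ _ _ D m
  (fun q => D q.1.1 /\ q.1.2 = s0 q.1.1 /\ q.2 = l q.1.1) (fun q => m q.1.1)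
  (fun i => (i, s0 i, l i)) (fun q => foldl (f q.1.1) q.1.2 q.2)) => //.
- by exists P, c => -[[i s] l'] /= [Di [-> ->]]; apply: hP.
- by apply: pc_pair hl; apply: pc_pair h0; apply: pc_id.
- by exists 1 => i _; rewrite mul1n expn1.
Qed.


(** * Closure under operations on pairs, booleans, lists and unary numbers *)

Lemma pc_fst I {cI : code I} (D : I -> Prop) m A B {cA : code A} {cB : code B} (F : I -> A * B) :
  pc D m F -> pc D m (fun i => (F i).1).
Proof. exact: (pc_projl (y := fun i => (F i).2)). Qed.

Lemma pc_snd I {cI : code I} (D : I -> Prop) m A B {cA : code A} {cB : code B} (F : I -> A * B) :
  pc D m F -> pc D m (fun i => (F i).2).
Proof. exact: (pc_projr (x := fun i => (F i).1)). Qed.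

Lemma pc_cons I {cI : code I} (D : I -> Prop) m A {cA : code A} (F : I -> A) (G : I -> seq A) :
  pc D m F -> pc D m G -> pc D m (fun i => F i :: G i).
Proof. exact: pc_node. Qed.

Lemma pc_nil I {cI : code I} (D : I -> Prop) m A {cA : code A} : pc D m (fun _ => [::] : seq A).
Proof. exact: pc_leaf. Qed.

Lemma pc_false I {cI : code I} (D : I -> Prop) m : pc D m (fun _ => false).
Proof. exact: pc_leaf. Qed.

Lemma pc_true I {cI : code I} (D : I -> Prop) m : pc D m (fun _ => true).
Proof. by apply: (@pc_node _ _ _ _ _ _ _ _ _ _ (fun _ => tt) (fun _ => tt)) => //; apply: pc_leaf. Qed.

Lemma pc_zero I {cI : code I} (D : I -> Prop) m : pc D m (fun _ => 0).
Proof. exact: pc_leaf. Qed.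

Lemma pc_succ I {cI : code I} (D : I -> Prop) m (F : I -> nat) : pc D m F -> pc D m (fun i => (F i).+1).
Proof. by apply: (@pc_node _ _ _ _ _ _ _ _ _ _ (fun _ => tt)) => //; apply: pc_leaf. Qed.

Lemma pc_const I {cI : code I} (D : I -> Prop) m (k : nat) : pc D m (fun _ => k).
Proof. by elim: k => [|k IH]; [apply: pc_zero | apply: pc_succ]. Qed.

Lemma pc_if I {cI : code I} (D : I -> Prop) m A {cA : code A} (b : I -> bool) (F G : I -> A) :
  pc D m b -> pc (fun i => D i /\ b i) m F -> pc (fun i => D i /\ ~~ b i) m G ->
  pc D m (fun i => if b i then F i else G i).
Proof.
move=> hb hF hG; apply: (pc_case hb).
  by apply: pc_ext (pc_mono hG _) _ => i [Di]; case: (b i).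
by apply: pc_ext (pc_mono hF _) _ => i [Di]; case: (b i).
Qed.

Lemma pc_andb I {cI : code I} (D : I -> Prop) m (b c : I -> bool) : pc D m b -> pc (fun i => D i /\ b i) m c -> pc D m (fun i => b i && c i).
Proof. by move=> hb hc; apply: (pc_if hb hc); apply: pc_false. Qed.

Lemma pc_orb I {cI : code I} (D : I -> Prop) m (b c : I -> bool) : pc D m b -> pc D m c -> pc D m (fun i => b i || c i).
Proof.
move=> hb hc; apply: (pc_if hb); first exact: pc_true.
by apply: pc_mono hc _ => i [].
Qed.

Lemma pc_negb I {cI : code I} (D : I -> Prop) m (b : I -> bool) : pc D m b -> pc D m (fun i => ~~ b i).
Proof. by move=> hb; apply: (pc_if hb); [apply: pc_false|apply: pc_true]. Qed.

Lemma pc_addb I {cI : code I} (D : I -> Prop) m (b c : I -> bool) : pc D m b -> pc D m c -> pc D m (fun i => b i (+) c i).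
Proof.
move=> hb hc; apply: (@pc_ext _ _ _ _ _ _ (fun i => if b i then ~~ c i else c i)).
  by apply: (pc_if hb); [apply: pc_mono (pc_negb hc) _ | apply: pc_mono hc _] => i [].
by move=> i _; case: (b i).
Qed.

Lemma pc_behead I {cI : code I} (D : I -> Prop) m A {cA : code A} (l : I -> seq A) :
  pc D m l -> pc D m (fun i => behead (l i)).
Proof.
move=> hl; apply: (pc_case hl).
  by apply: pc_ext (pc_nil _ _) _ => i []; case: (l i).
(* The type [A] has no default element with which to name the head, so the head is read as a bare
   tree. *)
case: hl => P [c hP]; apply: (@pc_projr I _ tree _ _ _ id _ _ _ l
   (fun i => if enc (l i) is Node x _ then x else Leaf)); last first.
  by exists P, c => i [Di _]; apply: hP.
by move=> i []; case: (l i).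
Qed.

Lemma pc_head I {cI : code I} (D : I -> Prop) m A {cA : code A} (x0 : I -> A) (l : I -> seq A) :
  pc D m x0 -> pc D m l -> pc D m (fun i => head (x0 i) (l i)).
Proof.
move=> h0 hl; apply: (pc_case hl).
  by apply: pc_ext (pc_mono h0 _) _ => i []; case: (l i).
apply: (@pc_projl _ _ _ _ _ _ _ _ _ _ l _ (fun i => behead (l i))); last first.
  by apply: pc_mono hl _ => i [].
by move=> i []; case: (l i).
Qed.

Lemma pc_nilp I {cI : code I} (D : I -> Prop) m A {cA : code A} (l : I -> seq A) :
  pc D m l -> pc D m (fun i => nilp (l i)).
Proof.
move=> hl; apply: (pc_case hl).
  by apply: pc_ext (pc_true _ _) _ => i []; case: (l i).
by apply: pc_ext (pc_false _ _) _ => i []; case: (l i).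
Qed.

Lemma enc_units n : enc (nseq n tt) = enc n.
Proof. by rewrite {1}/enc /code_list map_nseq. Qed.

Lemma pc_units I {cI : code I} (D : I -> Prop) m (F : I -> nat) :
  pc D m F -> pc D m (fun i => nseq (F i) tt).
Proof. by move=> hF; apply: pc_cast hF _ => i _; rewrite enc_units. Qed.

Lemma pc_pred I {cI : code I} (D : I -> Prop) m (F : I -> nat) :
  pc D m F -> pc D m (fun i => (F i).-1).
Proof.
move/pc_units/pc_behead => h; apply: pc_cast h _ => i _.
by rewrite -enc_units; case: (F i).
Qed.

Lemma pc_eq0 I {cI : code I} (D : I -> Prop) m (F : I -> nat) :
  pc D m F -> pc D m (fun i => F i == 0).
Proof.
by move/pc_units/pc_nilp => h; apply: pc_ext h _ => i _; rewrite /nilp size_nseq.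
Qed.

Lemma pc_iter I S {cI : code I} {cS : code S} (D : I -> Prop) m
    (f : I -> S -> S) (s0 : I -> S) (F : I -> nat) :
  pc D m s0 -> pc D m F -> pb D m F ->
  pc (fun q : I * S => D q.1 /\ exists2 j, j < F q.1 & q.2 = iter j (f q.1) (s0 q.1))
     (fun q => m q.1) (fun q => f q.1 q.2) ->
  pc D m (fun i => iter (F i) (f i) (s0 i)).
Proof.
move=> h0 hF bF hf.
have fE g (s : S) l : foldl (fun s _ => g s) s l = iter (@size unit l) g s.
  by elim: l s => //= a l IH s; rewrite IH -iterSr.
apply: pc_ext (pc_foldl (f := fun i s _ => f i s) h0 (pc_units hF) _ _) _.
- by apply: pb_le bF _ => i _; rewrite size_nseq.
- apply: (@pc_comp _ _ _ _ _ _ _ _ _ _ fst (fun q : I * S => f q.1 q.2) hf).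
  + exact: pc_fst (pc_id _ _).
  + move=> [[i s] a] /= [Di [l1 [l2 [e ->]]]]; split=> //.
    exists (size l1); rewrite ?fE //.
    by move: (congr1 size e); rewrite size_nseq size_cat /=; lia.
  + by exists 1 => q _; rewrite mul1n expn1.
- by move=> i _; rewrite fE size_nseq.
Qed.


Lemma pc_rev I {cI : code I} (D : I -> Prop) m A {cA : code A} (l : I -> seq A) :
  pc D m l -> pb D m (fun i => size (l i)) -> pc D m (fun i => rev (l i)).
Proof.
move=> hl bl; apply: pc_ext (pc_foldl (f := fun _ s a => a :: s) (pc_nil _ _) hl bl _) _.
  by apply: pc_cons; [apply: pc_snd | apply: pc_snd; apply: pc_fst]; apply: pc_id.
by move=> i _; rewrite /rev; elim: (l i) [::] => //= a s IH t; rewrite IH.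
Qed.

(** This is a left fold over the reversed list, so the states that occur are folds over suffixes. *)
Lemma pc_foldr I {cI : code I} (D : I -> Prop) m S A {cS : code S} {cA : code A}
    (f : I -> A -> S -> S) (s0 : I -> S) (l : I -> seq A) :
  pc D m s0 -> pc D m l -> pb D m (fun i => size (l i)) ->
  pc (fun q : I * S * A => D q.1.1 /\ exists l1 l2,
        l q.1.1 = l1 ++ q.2 :: l2 /\ q.1.2 = foldr (f q.1.1) (s0 q.1.1) l2)
     (fun q => m q.1.1) (fun q => f q.1.1 q.2 q.1.2) ->
  pc D m (fun i => foldr (f i) (s0 i) (l i)).
Proof.
move=> h0 hl bl hf.
apply: pc_ext (pc_foldl (f := fun i s a => f i a s) h0 (pc_rev hl bl) _ _) _.
- by apply: pb_le bl _ => i _; rewrite size_rev.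
- apply: pc_mono hf _ => -[[i s] a] /= [Di [l1 [l2 [e ->]]]]; split=> //.
  exists (rev l2), (rev l1); rewrite -(foldl_rev (fun s a => f i a s)) revK; split=> //.
  by rewrite -[l i]revK e rev_cat rev_cons cat_rcons.
- by move=> i _; rewrite foldl_rev.
Qed.

Lemma pc_map I {cI : code I} (D : I -> Prop) m (A : eqType) B {cA : code A} {cB : code B} (f : I -> A -> B) (l : I -> seq A) :
  pc D m l -> pb D m (fun i => size (l i)) ->
  pc (fun q : I * A => D q.1 /\ q.2 \in l q.1) (fun q => m q.1) (fun q => f q.1 q.2) ->
  pc D m (fun i => [seq f i a | a <- l i]).
Proof.
move=> hl bl hf.
apply: pc_ext (pc_foldr (f := fun i a s => f i a :: s) (pc_nil _ _) hl bl _) _.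
  apply: pc_cons; last by apply: pc_snd; apply: pc_fst; apply: pc_id.
  apply: (@pc_comp _ _ _ _ _ _ _ _ _ _ (fun q : I * _ * A => (q.1.1, q.2)) (fun q : I * A => f q.1 q.2) hf).
  - apply: pc_pair; first by apply: pc_fst; apply: pc_fst; apply: pc_id.
    by apply: pc_snd; apply: pc_id.
  - move=> [[i s] a] /= [Di [l1 [l2 [e _]]]]; split=> //.
    by rewrite e mem_cat inE eqxx orbT.
  - by exists 1 => q _; rewrite mul1n expn1.
by move=> i _; elim: (l i) => //= a s ->.
Qed.

Lemma pc_filter I {cI : code I} (D : I -> Prop) m (A : eqType) {cA : code A} (f : I -> A -> bool) (l : I -> seq A) :
  pc D m l -> pb D m (fun i => size (l i)) ->
  pc (fun q : I * A => D q.1 /\ q.2 \in l q.1) (fun q => m q.1) (fun q => f q.1 q.2) ->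
  pc D m (fun i => [seq a <- l i | f i a]).
Proof.
move=> hl bl hf.
apply: pc_ext (pc_foldr (f := fun i a s => if f i a then a :: s else s) (pc_nil _ _) hl bl _) _.
  apply: pc_if; last by apply: pc_snd; apply: pc_fst; apply: pc_id.
    apply: (@pc_comp _ _ _ _ _ _ _ _ _ _ (fun q : I * _ * A => (q.1.1, q.2)) (fun q : I * A => f q.1 q.2) hf).
    - apply: pc_pair; first by apply: pc_fst; apply: pc_fst; apply: pc_id.
      by apply: pc_snd; apply: pc_id.
    - move=> [[i s] a] /= [Di [l1 [l2 [e _]]]]; split=> //.
      by rewrite e mem_cat inE eqxx orbT.
    - by exists 1 => q _; rewrite mul1n expn1.
  by apply: pc_cons; [apply: pc_snd | apply: pc_snd; apply: pc_fst]; apply: pc_id.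
by move=> i _; elim: (l i) => //= a s ->.
Qed.

Lemma pc_has I {cI : code I} (D : I -> Prop) m (A : eqType) {cA : code A} (f : I -> A -> bool) (l : I -> seq A) :
  pc D m l -> pb D m (fun i => size (l i)) ->
  pc (fun q : I * A => D q.1 /\ q.2 \in l q.1) (fun q => m q.1) (fun q => f q.1 q.2) ->
  pc D m (fun i => has (f i) (l i)).
Proof.
move=> hl bl hf; apply: pc_ext (pc_negb (pc_nilp (pc_filter hl bl hf))) _ => i _.
by rewrite /nilp size_filter has_count lt0n.
Qed.

Lemma pc_all I {cI : code I} (D : I -> Prop) m (A : eqType) {cA : code A} (f : I -> A -> bool) (l : I -> seq A) :
  pc D m l -> pb D m (fun i => size (l i)) ->
  pc (fun q : I * A => D q.1 /\ q.2 \in l q.1) (fun q => m q.1) (fun q => f q.1 q.2) ->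
  pc D m (fun i => all (f i) (l i)).
Proof.
move=> hl bl hf; apply: pc_ext (pc_negb (pc_has hl bl (pc_negb hf))) _ => i _.
by rewrite -all_predC; apply: eq_all => a /=; apply: negbK.
Qed.

Lemma pc_cat I {cI : code I} (D : I -> Prop) m A {cA : code A} (k l : I -> seq A) :
  pc D m k -> pb D m (fun i => size (k i)) -> pc D m l ->
  pc D m (fun i => k i ++ l i).
Proof.
move=> hk bk hl.
apply: pc_ext (pc_foldr (f := fun _ a s => a :: s) hl hk bk _) _.
  by apply: pc_cons; [apply: pc_snd | apply: pc_snd; apply: pc_fst]; apply: pc_id.
by move=> i _; elim: (k i) => //= a s ->.
Qed.

Lemma pc_flatten I {cI : code I} (D : I -> Prop) m (A : eqType) {cA : code A} (l : I -> seq (seq A)) :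
  pc D m l -> pb D m (fun i => size (l i)) ->
  pb (fun q : I * seq A => D q.1 /\ q.2 \in l q.1) (fun q => m q.1) (fun q => size q.2) ->
  pc D m (fun i => flatten (l i)).
Proof.
move=> hl bl hb.
apply: (pc_foldr (f := fun _ a s => a ++ s) (pc_nil _ _) hl bl).
apply: pc_cat; first by apply: pc_snd; apply: pc_id.
  apply: (@pb_comp _ _ _ _ _ _ (fun q => size q.2) (fun q : I * seq A * seq A => (q.1.1, q.2)) hb).
    move=> [[i s] a] /= [Di [l1 [l2 [e _]]]]; split=> //.
    by rewrite e mem_cat inE eqxx orbT.
  by exists 1 => q _; rewrite mul1n expn1.
by apply: pc_snd; apply: pc_fst; apply: pc_id.
Qed.

Lemma pc_size I {cI : code I} (D : I -> Prop) m A {cA : code A} (l : I -> seq A) :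
  pc D m l -> pb D m (fun i => size (l i)) -> pc D m (fun i => size (l i)).
Proof.
move=> hl bl; apply: pc_ext (pc_foldr (f := fun _ _ s => s.+1) (pc_zero _ _) hl bl _) _.
  by apply: pc_succ; apply: pc_snd; apply: pc_fst; apply: pc_id.
by move=> i _; elim: (l i) => //= a s ->.
Qed.

Lemma pc_add I {cI : code I} (D : I -> Prop) m (F G : I -> nat) : pc D m F -> pc D m G -> pb D m G -> pc D m (fun i => F i + G i).
Proof.
move=> hF hG bG; apply: pc_ext (pc_iter (f := fun _ => succn) hF hG bG _) _.
  by apply: pc_succ; apply: pc_snd; apply: pc_id.
by move=> i _; rewrite iter_succn.
Qed.

Lemma pc_sub I {cI : code I} (D : I -> Prop) m (F G : I -> nat) : pc D m F -> pc D m G -> pb D m G -> pc D m (fun i => F i - G i).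
Proof.
move=> hF hG bG; apply: pc_ext (pc_iter (f := fun _ => predn) hF hG bG _) _.
  by apply: pc_pred; apply: pc_snd; apply: pc_id.
by move=> i _; rewrite iter_predn.
Qed.

Lemma pc_leq I {cI : code I} (D : I -> Prop) m (F G : I -> nat) : pc D m F -> pc D m G -> pb D m G -> pc D m (fun i => F i <= G i).
Proof. by move=> hF hG bG; apply: pc_eq0; apply: pc_sub. Qed.

Lemma pc_minn I {cI : code I} (D : I -> Prop) m (F G : I -> nat) : pc D m F -> pc D m G -> pb D m F -> pb D m G -> pc D m (fun i => minn (F i) (G i)).
Proof.
move=> hF hG bF bG; apply: (pc_ext (F := fun i => F i - (F i - G i))).
  apply: pc_sub => //; first exact: pc_sub.
  by apply: pb_le bF _ => i _; lia.
by move=> i _; lia.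
Qed.

Lemma pc_eqn I {cI : code I} (D : I -> Prop) m (F G : I -> nat) : pc D m F -> pc D m G -> pb D m F -> pb D m G ->
  pc D m (fun i => F i == G i).
Proof.
move=> hF hG bF bG; apply: (pc_ext (F := fun i => (F i <= G i) && (G i <= F i))).
  by apply: pc_andb; [apply: pc_leq | apply: pc_mono (pc_leq hG hF bF) _ => i []].
by move=> i _; rewrite eqn_leq.
Qed.

Lemma pc_drop I {cI : code I} (D : I -> Prop) m A {cA : code A} (F : I -> nat) (l : I -> seq A) :
  pc D m F -> pb D m F -> pc D m l -> pc D m (fun i => drop (F i) (l i)).
Proof.
move=> hF bF hl; apply: pc_ext (pc_iter (f := fun _ => behead) hl hF bF _) _.
  by apply: pc_behead; apply: pc_snd; apply: pc_id.
move=> i _; elim: (F i) => [|k IH]; first by rewrite drop0.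
by rewrite iterS IH -drop1 drop_drop add1n.
Qed.

Lemma pc_nth I {cI : code I} (D : I -> Prop) m A {cA : code A} (F : I -> nat) (x0 : I -> A) (l : I -> seq A) :
  pc D m F -> pb D m F -> pc D m x0 -> pc D m l ->
  pc D m (fun i => nth (x0 i) (l i) (F i)).
Proof.
move=> hF bF h0 hl; apply: pc_ext (pc_head h0 (pc_drop hF bF hl)) _ => i _.
by rewrite -nth0 nth_drop addn0.
Qed.

Lemma pc_iota I {cI : code I} (D : I -> Prop) m (F : I -> nat) : pc D m F -> pb D m F -> pc D m (fun i => iota 0 (F i)).
Proof.
move=> hF bF.
have E k : iota 0 k = iter k (fun s => 0 :: [seq j.+1 | j <- s]) [::].
  by elim: k => //= k <-; rewrite -[1]addn0 iotaDl.
apply: pc_ext (pc_iter (f := fun _ s => 0 :: [seq j.+1 | j <- s]) (pc_nil _ _) hF bF _) _.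
  apply: pc_cons; first exact: pc_zero.
  apply: pc_map; first by apply: pc_snd; apply: pc_id.
    have b' : pb (fun q : I * seq nat => D q.1) (fun q => m q.1) (fun q => F q.1).
      by apply: pb_comp bF _ (pb_m _ _).
    case: b' => c hc; exists c => -[i s] /= [Di [j lj ->]]; apply: leq_trans (hc (i, s) Di).
    by rewrite -E size_iota /= ltnW.
  by apply: pc_succ; apply: pc_snd; apply: pc_id.
by move=> i _; rewrite E.
Qed.

Lemma pc_eqbits I {cI : code I} (D : I -> Prop) m (k l : I -> seq bool) :
  pc D m k -> pc D m l -> pb D m (fun i => size (k i)) -> pb D m (fun i => size (l i)) ->
  pc D m (fun i => k i == l i).
Proof.
move=> hk hl bk bl.
apply: (@pc_ext _ _ _ _ _ _ (fun i => (size (k i) == size (l i)) &&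
   all (fun j => ~~ (nth false (k i) j (+) nth false (l i) j)) (iota 0 (size (k i))))).
  have W A (cA : code A) (F : I -> A) : pc D m F ->
     pc (fun q : I * nat => (D q.1 /\ size (k q.1) == size (l q.1)) /\ q.2 \in iota 0 (size (k q.1)))
       (fun q => m q.1) (fun q => F q.1).
    move=> hF; apply: pc_comp hF _ _ _; first exact: pc_fst (pc_id _ _).
      by move=> q [[]].
    exact: pb_m.
  have bi : pb (fun q : I * nat => (D q.1 /\ size (k q.1) == size (l q.1)) /\ q.2 \in iota 0 (size (k q.1)))
       (fun q => m q.1) (fun q => q.2).
    apply: (@pb_le _ _ _ _ (fun q => size (k q.1))).
      by apply: (pb_comp bk) (pb_m _ _) => q [[]].
    by move=> q [_]; rewrite mem_iota => /andP [_ /ltnW].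
  apply: pc_andb; first by apply: pc_eqn => //; apply: pc_size.
  have W' A (cA : code A) (F : I -> A) : pc D m F ->
     pc (fun i => D i /\ size (k i) == size (l i)) m F.
    by move=> hF; apply: pc_mono hF _ => i [].
  apply: pc_all.
  - apply: W'; apply: pc_iota => //; exact: pc_size.
  - by case: bk => c hc; exists c => i [Di _]; rewrite size_iota; apply: hc.
  - apply: pc_negb; apply: pc_addb; apply: pc_nth;
      by [exact: bi | apply: pc_snd; apply: pc_id | apply: pc_false | apply: W].
move=> i _; apply/andP/eqP => [[/eqP e /allP h]|->].
  apply: (eq_from_nth (x0 := false) e) => j lj.
  by apply/eqP; rewrite -negb_add; apply: h; rewrite mem_iota.
by split=> //; apply/allP => j _; rewrite addbb.
Qed.



Lemma pc_mem I {cI : code I} (D : I -> Prop) m (A : eqType) {cA : code A} (x : I -> A) (l : I -> seq A) :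
  pc D m l -> pb D m (fun i => size (l i)) ->
  pc (fun q : I * A => D q.1 /\ q.2 \in l q.1) (fun q => m q.1) (fun q => x q.1 == q.2) ->
  pc D m (fun i => x i \in l i).
Proof.
move=> hl bl he; apply: pc_ext (pc_has hl bl he) _ => i _.
by rewrite -has_pred1; apply: eq_has => a /=; rewrite eq_sym.
Qed.

Lemma pc_undup I {cI : code I} (D : I -> Prop) m (A : eqType) {cA : code A} (l : I -> seq A) :
  pc D m l -> pb D m (fun i => size (l i)) ->
  pc (fun q : I * A * A => [/\ D q.1.1, q.1.2 \in l q.1.1 & q.2 \in l q.1.1])
    (fun q => m q.1.1) (fun q => q.1.2 == q.2) ->
  pc D m (fun i => undup (l i)).
Proof.
move=> hl bl he.
have E (s : seq A) : undup s = foldr (fun a t => if a \in t then t else a :: t) [::] s.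
  by elim: s => //= a s <-; rewrite mem_undup.
apply: pc_ext (pc_foldr (f := fun _ a t => if a \in t then t else a :: t) (pc_nil _ _) hl bl _) _;
  last by move=> i _; rewrite E.
have p1 D' m' : pc D' m' (fun q : I * seq A * A => q.1.2).
  by apply: pc_snd; apply: pc_fst; apply: pc_id.
apply: pc_if; first apply: pc_mem => //.
- case: bl => c hc; exists c => -[[i s] a] /= [Di [l1 [l2 [e ->]]]]; rewrite -E.
  apply: leq_trans (hc i Di); apply: leq_trans (size_undup _) _.
  by rewrite e size_cat /=; lia.
- apply: (@pc_comp _ _ _ _ _ _ _ _ _ _ (fun q : I * seq A * A * A => (q.1.1.1, q.1.2, q.2))
    (fun q : I * A * A => q.1.2 == q.2) he).
  + apply: pc_pair; last exact: pc_snd (pc_id _ _).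
    by apply: pc_pair; [apply: pc_fst; apply: pc_fst | apply: pc_snd]; apply: pc_fst; apply: pc_id.
  + move=> [[[i s] a] b] /= [[Di [l1 [l2 [e ->]]]]]; rewrite -E mem_undup => bl2.
    by split; rewrite // e mem_cat inE ?eqxx ?bl2 !orbT.
  + exact: pb_m.
- exact: p1.
- by apply: pc_cons (p1 _ _); apply: pc_snd; apply: pc_id.
Qed.


Lemma pc_wk I B A {cI : code I} {cB : code B} {cA : code A} (D : I -> Prop)
    (D' : I * B -> Prop) m (F : I -> A) :
  pc D m F -> (forall q, D' q -> D q.1) -> pc D' (fun q => m q.1) (fun q => F q.1).
Proof.
move=> hF hD; apply: pc_comp hF (pc_fst (pc_id _ _)) hD _; exact: pb_m.
Qed.

Lemma pb_wk I B (D : I -> Prop) (D' : I * B -> Prop) m (F : I -> nat) :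
  pb D m F -> (forall q, D' q -> D q.1) -> pb D' (fun q => m q.1) (fun q => F q.1).
Proof. by move=> hF hD; apply: pb_comp hF hD (pb_m _ _). Qed.

Lemma pb_mono I (D D' : I -> Prop) m F : pb D' m F -> (forall i, D i -> D' i) -> pb D m F.
Proof. by move=> [c h] hD; exists c => i /hD; apply: h. Qed.

(** Substitution for the frequent case in which the new measure is by definition the old one at
    [g q], so that no comparison of measures is left to prove. *)
Lemma pc_re I J A {cI : code I} {cJ : code J} {cA : code A} (D : I -> Prop)
    (D' : J -> Prop) m (g : J -> I) (F : I -> A) :
  pc D m F -> pc D' (fun q => m (g q)) g -> (forall q, D' q -> D (g q)) ->
  pc D' (fun q => m (g q)) (fun q => F (g q)).
Proof. by move=> hF hg hD; apply: pc_comp hF hg hD (pb_m _ _). Qed.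

Lemma pc_1 I B {cI : code I} {cB : code B} D m : pc D m (fun q : I * B => q.1).
Proof. exact: pc_fst (pc_id _ _). Qed.

Lemma pc_2 I B {cI : code I} {cB : code B} D m : pc D m (fun q : I * B => q.2).
Proof. exact: pc_snd (pc_id _ _). Qed.

(** * Dynamic programming over separated pairs *)

Definition orv (a b : seq bool) :=
  [seq nth false a j || nth false b j | j <- iota 0 (size a)].

Lemma pc_orv I {cI : code I} (D : I -> Prop) m (a b : I -> seq bool) :
  pc D m a -> pc D m b -> pb D m (fun i => size (a i)) ->
  pc D m (fun i => orv (a i) (b i)).
Proof.
move=> ha hb sa.
have bi : pb (fun q : I * nat => D q.1 /\ q.2 \in iota 0 (size (a q.1)))
       (fun q => m q.1) (fun q => q.2).
  apply: (@pb_le _ _ _ _ (fun q => size (a q.1))); first by apply: pb_wk sa _ => q [].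
  by move=> q [_]; rewrite mem_iota => /andP [_ /ltnW].
apply: pc_map.
- by apply: pc_iota => //; apply: pc_size.
- by apply: pb_le sa _ => i _; rewrite size_iota.
- apply: pc_orb; (apply: pc_nth; [exact: pc_2 | exact: bi | exact: pc_false | ]).
    by apply: pc_wk ha _ => q [].
  by apply: pc_wk hb _ => q [].
Qed.

Definition state : Type := nat * seq bool.

Definition combine (s o : state) : state := (s.1 + o.1, orv s.2 o.2).

Definition dp_step (L g : seq state) : seq state :=
  undup (flatten [seq [seq combine s o | o <- g] | s <- L]).

Definition dp (init : seq bool) (gs : seq (seq state)) : seq state :=
  foldl dp_step [:: (0, init)] gs.

(** [List.In] instead of [\in] lets the elements be of any type, without decidable equality. *)
Definition elem_pb I A (D : I -> Prop) m (L : I -> seq A) (F : A -> nat) :=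
  pb (fun q : I * A => D q.1 /\ List.In q.2 (L q.1)) (fun q => m q.1) (fun q => F q.2).

Lemma InP (A : eqType) (x : A) s : reflect (List.In x s) (x \in s).
Proof.
elim: s => [|a s IH] /=; first by constructor.
rewrite inE; apply: (iffP orP) => [[/eqP ->|/IH]|[->|/IH]]; by [left|right].
Qed.

Lemma dp_step_mem L g s : s \in dp_step L g ->
  exists a b, [/\ a \in L, b \in g & s = combine a b].
Proof.
by rewrite mem_undup => /flatten_mapP [a aL /mapP [b bg ->]]; exists a, b.
Qed.

Lemma pc_dp_step I {cI : code I} (D : I -> Prop) m (L g : I -> seq state) :
  pc D m L -> pb D m (fun i => size (L i)) -> pc D m g -> pb D m (fun i => size (g i)) ->
  elem_pb D m L (fun s => s.1) -> elem_pb D m g (fun s => s.1) ->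
  elem_pb D m L (fun s => size s.2) ->
  pc D m (fun i => dp_step (L i) (g i)).
Proof.
move=> hL bL hg bg cL cg vL; rewrite /dp_step.
pose F i := flatten [seq [seq combine s o | o <- g i] | s <- L i].
(* Removing duplicates compares states, and comparison reads unary numbers and bit vectors
   completely. Hence both components of a combined state have to be bounded. *)
have [cst bcst] : exists c, forall i s o, D i -> s \in L i -> o \in g i ->
    s.1 + o.1 <= c * (m i).+1 ^ c.
  have [c hc] : pb (fun q : I * state * state => [/\ D q.1.1, q.1.2 \in L q.1.1 & q.2 \in g q.1.1])
      (fun q => m q.1.1) (fun q => q.1.2.1 + q.2.1).
    apply: pb_add.
      apply: (@pb_comp _ _ _ _ _ _ _ fst cL) (pb_m _ _) => -[[i s] o] /= [? /InP] //.
    apply: (@pb_comp _ _ _ _ _ _ _ (fun q => (q.1.1, q.2)) cg) (pb_m _ _) => -[[i s] o] /= [? _ /InP] //.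
  by exists c => i s o Di si oi; apply: (hc (i, s, o)).
have [csv bcsv] : exists c, forall i s, D i -> s \in L i -> size s.2 <= c * (m i).+1 ^ c.
  by case: vL => c hc; exists c => i s Di /InP si; apply: (hc (i, s)).
have hrow : pc (fun q : I * state => D q.1 /\ q.2 \in L q.1) (fun q => m q.1)
    (fun q => [seq combine q.2 o | o <- g q.1]).
  apply: pc_map.
  - by apply: pc_wk hg _ => q [].
  - by apply: pb_wk bg _ => q [].
  - apply: pc_pair.
      apply: pc_add; [apply: pc_fst; apply: pc_snd; exact: pc_1|apply: pc_fst; exact: pc_2|].
      apply: (@pb_comp _ _ _ _ _ _ _ (fun q => (q.1.1, q.2)) cg) (pb_m _ _).
      by move=> -[[i s] o] /= [[? _] /InP].
    apply: pc_orv; [apply: pc_snd; apply: pc_snd; exact: pc_1|apply: pc_snd; exact: pc_2|].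
    by exists csv => -[[i s] o] /= [[Di si] _]; apply: bcsv.
have sF i : size (F i) = size (L i) * size (g i).
  rewrite /F; elim: (L i) => //= s l IH.
  by rewrite size_cat IH size_map mulSn.
have hF : pc D m F.
  apply: pc_flatten.
  - exact: pc_map hL bL hrow.
  - by apply: pb_le bL _ => i _; rewrite size_map.
  - apply: (@pb_le _ _ _ _ (fun q => size (g q.1))); first by apply: pb_wk bg _ => q [].
    by move=> [i r] /= [_ /mapP [s _ ->]]; rewrite size_map.
have bF : pb D m (fun i => size (F i)) by apply: pb_le (pb_mul bL bg) _ => i _; rewrite sF.
apply: pc_undup hF bF _.
have e1 i s : D i -> s \in F i -> s.1 <= cst * (m i).+1 ^ cst.
  by move=> Di /flatten_mapP [a aL /mapP [b bg' ->]]; apply: bcst.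
have e2 i s : D i -> s \in F i -> size s.2 <= csv * (m i).+1 ^ csv.
  by move=> Di /flatten_mapP [a aL /mapP [b bg' ->]]; rewrite /= size_map size_iota; apply: bcsv.
apply: (pc_ext (F := fun q : I * state * state => (q.1.2.1 == q.2.1) && (q.1.2.2 == q.2.2)));
  last by move=> q _; rewrite -xpair_eqE -!surjective_pairing.
have x1 D' m' : pc D' m' (fun q : I * state * state => q.1.2) by apply: pc_snd; exact: pc_1.
apply: pc_andb; [apply: pc_eqn|apply: pc_eqbits].
- by apply: pc_fst.
- by apply: pc_fst; exact: pc_2.
- by exists cst => -[[i s] o] /= [Di si oi]; apply: e1.
- by exists cst => -[[i s] o] /= [Di si oi]; apply: e1.
- by apply: pc_snd.
- by apply: pc_snd; exact: pc_2.
- by exists csv => -[[i s] o] /= [[Di si oi] _]; apply: e2.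
- by exists csv => -[[i s] o] /= [[Di si oi] _]; apply: e2.
Qed.

(** [orv] keeps the length of its first argument, so the length of [init] is preserved whatever the
    options are. *)
Lemma dp_size init gs s : s \in dp init gs -> size s.2 = size init.
Proof.
rewrite /dp; elim/last_ind: gs s => [|gs g IH] s; first by rewrite inE => /eqP ->.
by rewrite foldl_rcons => /dp_step_mem [a [b [/IH <- _ ->]]]; rewrite /= size_map size_iota.
Qed.

(** The intermediate tables are the values of [dp] on prefixes of [gs]; the bounds on their number
    of states and on the counts in them are therefore required for all prefixes. *)
Lemma pc_dp I {cI : code I} (D : I -> Prop) m (init : I -> seq bool) (gs : I -> seq (seq state)) :
  pc D m init -> pb D m (fun i => size (init i)) ->
  pc D m gs -> pb D m (fun i => size (gs i)) ->
  elem_pb D m gs size ->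
  elem_pb D m (fun i => flatten (gs i)) (fun s => s.1) ->
  pb (fun q => D q.1 /\ exists l2, gs q.1 = q.2 ++ l2) (fun q => m q.1)
     (fun q => size (dp (init q.1) q.2)) ->
  pb (fun q => D q.1.1 /\ exists2 l2, gs q.1.1 = q.1.2 ++ l2 & q.2 \in dp (init q.1.1) q.1.2)
     (fun q => m q.1.1) (fun q => q.2.1) ->
  pc D m (fun i => dp (init i) (gs i)).
Proof.
move=> hi bi hg bg eg cg bs cs; rewrite /dp.
apply: (pc_foldl (f := fun _ => dp_step)) => //.
  apply: pc_cons; last exact: pc_nil.
  by apply: pc_pair; first exact: pc_zero.
apply: pc_dp_step.
- by apply: pc_snd; exact: pc_1.
- case: bs => c hc; exists c => -[[i L] g] /= [Di [l1 [l2 [e ->]]]].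
  by apply: (hc (i, l1)); split=> //; exists (g :: l2).
- exact: pc_2.
- case: eg => c hc; exists c => -[[i L] g] /= [Di [l1 [l2 [e _]]]].
  apply: (hc (i, g)); split=> //=; apply/InP.
  by rewrite e mem_cat inE eqxx orbT.
- case: cs => c hc; exists c => -[[[i L] g] s] /= [[Di [l1 [l2 [e ->]]]] /InP ss].
  by apply: (hc (i, l1, s)); split=> //; exists (g :: l2).
- case: cg => c hc; exists c => -[[[i L] g] s] /= [[Di [l1 [l2 [e _]]]] /InP ss].
  apply: (hc (i, s)); split=> //=; apply/InP/flattenP; exists g => //.
  by rewrite e mem_cat inE eqxx orbT.
- case: bi => c hc; exists c => -[[[i L] g] s] /= [[Di [l1 [l2 [e ->]]]] /InP ss].
  by rewrite (dp_size ss); apply: hc.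
Qed.

(** The last group is added by [rcons], matching the left fold in [dp]. *)
Inductive choice (T : eqType) : seq (seq (seq T)) -> seq T -> Prop :=
| Choice0 : choice [::] [::]
| ChoiceS G g c o : choice G c -> o \in g -> choice (rcons G g) (c ++ o).

Lemma choice_nil (T : eqType) (c : seq T) : choice [::] c -> c = [::].
Proof. by move eH: [::] => H h; case: h eH => // -[]. Qed.

Lemma choice_rcons (T : eqType) G g (c : seq T) : choice (rcons G g) c ->
  exists c' o, [/\ choice G c', o \in g & c = c' ++ o].
Proof.
move eH : (rcons G g) => H h; case: h eH => [|G' g' c' o h og]; first by case: G.
by move/eqP; rewrite eqseq_rcons => /andP [/eqP -> /eqP ->]; exists c', o.
Qed.

Section Choice.
Variables (T A : eqType) (f : T -> A -> bool) (ini : A -> A -> bool) (X : seq A).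

Definition item_pairs : seq (A * A) := flatten [seq [seq (x, y) | y <- X] | x <- X].

Definition separates (c : seq T) (x y : A) := has (fun t => f t x (+) f t y) c.

Definition option_state (c : seq T) : state :=
  (size c, [seq separates c q.1 q.2 | q <- item_pairs]).

Definition tabulate (G : seq (seq (seq T))) : seq (seq state) :=
  [seq [seq option_state o | o <- g] | g <- G].

(** [ini] marks the pairs that count as separated from the start: equal items for Test Cover, the
    pairs dealt with by the guess for Locating-Dominating Set. *)
Definition init_state : seq bool := [seq ini q.1 q.2 | q <- item_pairs].

Definition choice_ok (K : nat) (G : seq (seq (seq T))) : bool :=
  has (fun s : state => (s.1 <= K) && all id s.2) (dp init_state (tabulate G)).

Definition choice_state c : state :=
  (size c, [seq ini q.1 q.2 || separates c q.1 q.2 | q <- item_pairs]).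

Lemma orv_map (B : Type) (u v : B -> bool) (s : seq B) :
  orv [seq u b | b <- s] [seq v b | b <- s] = [seq u b || v b | b <- s].
Proof.
rewrite /orv size_map; apply: (eq_from_nth (x0 := false)); first by rewrite !size_map size_iota.
move=> j; rewrite size_map size_iota => lj; rewrite (nth_map 0) ?size_iota // nth_iota // add0n.
by case: s lj => // b s lj; rewrite !(nth_map b).
Qed.

Lemma combine_choice c o : combine (choice_state c) (option_state o) = choice_state (c ++ o).
Proof.
rewrite /combine /choice_state /= size_cat orv_map; congr (_, _).
by apply: eq_map => q; rewrite /separates has_cat orbA.
Qed.

Lemma dpP G s : s \in dp init_state (tabulate G) <-> exists2 c, choice G c & s = choice_state c.
Proof.
elim/last_ind: G s => [|G g IH] s.
  rewrite inE; split=> [/eqP ->|].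
    exists [::]; first exact: Choice0.
    by congr (_, _); apply: eq_map => q; rewrite orbF.
  by case=> c /choice_nil -> ->; apply/eqP; congr (_, _); apply: eq_map => q; rewrite orbF.
rewrite /tabulate map_rcons /dp foldl_rcons; split.
  move=> /dp_step_mem [a [b [/IH [c hc ->] /mapP [o og ->] ->]]].
  by exists (c ++ o); [apply: ChoiceS | rewrite combine_choice].
case=> c /choice_rcons [c' [o [hc' og ->]]] ->; rewrite mem_undup.
apply/flatten_mapP; exists (choice_state c'); first by apply/IH; exists c'.
by apply/mapP; exists (option_state o); rewrite ?combine_choice ?map_f.
Qed.

Lemma choice_okP K G : choice_ok K G <-> exists c, [/\ choice G c, size c <= K &
  forall x y, x \in X -> y \in X -> ini x y || separates c x y].
Proof.
split=> [/hasP [s /dpP [c hc ->] /andP [sK /allP h]]|[c [hc sK h]]].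
  exists c; split=> // x y xX yX; apply: h; apply/mapP; exists (x, y) => //.
  by apply/flatten_mapP; exists x => //; apply: map_f.
apply/hasP; exists (choice_state c); first by apply/dpP; exists c.
rewrite sK /=; apply/allP => _ /mapP [q /flatten_mapP [x xX /mapP [y yX ->]] ->].
exact: h.
Qed.

(* A state only depends on a size and on the kernel of the map sending an item
   to the list of chosen tests containing it; every kernel on a set of k items
   is that of a map into k values. *)
Lemma size_dp G N : (forall c, choice G c -> size c <= N) ->
  size (dp init_state (tabulate G)) <= N.+1 * size X ^ size X.
Proof.
move=> hN; set k := size X.
pose V (t : k.-tuple 'I_k) := [seq ini q.1 q.2 ||
   (nth 0 (map val t) (index q.1 X) != nth 0 (map val t) (index q.2 X)) | q <- item_pairs].
pose U := flatten [seq [seq (n, V t) | t <- enum {: k.-tuple 'I_k}] | n <- iota 0 N.+1].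
have <- : size U = N.+1 * k ^ k.
  rewrite /U; elim: N.+1 0 => // n IH j /=.
  by rewrite size_cat IH size_map -cardE card_tuple card_ord mulSn.
apply: uniq_leq_size.
  by case/lastP: G {hN} => // G g; rewrite /tabulate map_rcons /dp foldl_rcons undup_uniq.
move=> s /dpP [c hc ->]; apply/flatten_mapP; exists (size c).
  by rewrite mem_iota add0n ltnS hN.
pose g x := [seq f t x | t <- c].
have lt x : x \in X -> index (g x) (map g X) < k by move=> xX; rewrite /k -(size_map g) index_mem map_f.
have kg x : x \in X -> nth (g x) (map g X) (index (g x) (map g X)) = g x.
  by move=> xX; rewrite nth_index ?map_f.
(* [h] sends a position in [X] to the first position whose item lies in the same chosen tests;
   images agree exactly when no test of [c] separates the items. *)
pose h (j : 'I_k) : 'I_k := insubd j (index (g (nth (tnth (in_tuple X) j) X j)) (map g X)).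
apply/mapP; exists [tuple h j | j < k]; first by rewrite mem_enum.
congr (_, _); apply/eq_in_map => q /flatten_mapP [x xX /mapP [y yX ->]] /=; congr (_ || _).
have hE z : z \in X -> nth 0 [seq val i | i <- [seq h j | j <- enum 'I_k]] (index z X)
      = index (g z) (map g X).
  move=> zX; have lz : index z X < k by rewrite /k index_mem.
  rewrite (nth_map (Ordinal lz)) ?size_map -?enumT ?size_enum_ord //.
  rewrite (nth_map (Ordinal lz)) ?size_enum_ord // (_ : nth _ _ _ = Ordinal lz); last first.
    by apply: val_inj; rewrite /= nth_enum_ord.
  by rewrite /h /= nth_index // val_insubd lt.
rewrite !hE //; apply/idP/idP; last first.
  move=> ne; apply: contraNT ne => /hasPn hs; apply/eqP; congr (index _ _).
  by apply/eq_in_map => t tc; move: (hs t tc); rewrite negb_add => /eqP.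
apply: contraTN => /eqP e.
have {}e : g x = g y by rewrite -(kg x) // -(kg y) // e; apply: set_nth_default; rewrite size_map -/k lt.
apply/hasPn => t tc; rewrite negb_add; apply/eqP.
by move/eq_in_map: e => /(_ t tc).
Qed.

End Choice.

Lemma mem_item_pairs (A : eqType) (X : seq A) q :
  (q \in item_pairs X) = (q.1 \in X) && (q.2 \in X).
Proof.
apply/flatten_mapP/andP => [[x xX /mapP [y yX ->]] //|[xX yX]].
by exists q.1 => //; apply/mapP; exists q.2; rewrite // -surjective_pairing.
Qed.

Lemma size_item_pairs (A : eqType) (X : seq A) : size (item_pairs X) = size X * size X.
Proof.
rewrite /item_pairs.
have H (Y Z : seq A) : size (flatten [seq [seq (x, y) | y <- Z] | x <- Y]) = size Y * size Z.
  by elim: Y => //= y Y IH; rewrite size_cat IH size_map mulSn.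
exact: H.
Qed.

Lemma pc_item_pairs I {cI : code I} (D : I -> Prop) m (A : eqType) {cA : code A} (X : I -> seq A) :
  pc D m X -> pb D m (fun i => size (X i)) -> pc D m (fun i => item_pairs (X i)).
Proof.
move=> hX bX; rewrite /item_pairs; apply: pc_flatten.
- apply: (pc_map (f := fun i x => [seq (x, y) | y <- X i])) => //.
  apply: (pc_map (f := fun (q : I * A) y => (q.2, y))).
  + by apply: pc_wk hX _ => q [].
  + by apply: pb_wk bX _ => q [].
  + by apply: pc_pair; [apply: pc_snd; exact: pc_1 | exact: pc_2].
- by apply: pb_le bX _ => i _; rewrite size_map.
- apply: (@pb_le _ _ _ _ (fun q => size (X q.1))); first by apply: pb_wk bX _ => q [].
  by move=> [i r] /= [_ /mapP [x _ ->]]; rewrite size_map.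
Qed.

(** * Running time of the choice problem *)

Section PcChoice.
Context (I : Type) {cI : code I} (D : I -> Prop) (m : I -> nat).
Context (T A : eqType) {cT : code T} {cA : code A}.
Variables (f : I -> T -> A -> bool) (ini : I -> A -> A -> bool).
Variables (X : I -> seq A) (K : I -> nat) (G : I -> seq (seq (seq T))).
Hypotheses (hX : pc D m X) (bX : pb D m (fun i => size (X i))).
Hypotheses (bXX : pb D m (fun i => size (X i) ^ size (X i))).
Hypotheses (hG : pc D m G) (bG : pb D m (fun i => size (G i))).
Hypotheses (bg : elem_pb D m G size) (bo : elem_pb D m (fun i => flatten (G i)) size).
Hypotheses (hK : pc D m K) (bK : pb D m K).
Hypothesis hf : pc (fun q : I * T * A =>
    [/\ D q.1.1, exists2 o, o \in flatten (G q.1.1) & q.1.2 \in o & q.2 \in X q.1.1])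
  (fun q => m q.1.1) (fun q => f q.1.1 q.1.2 q.2).
Hypothesis hini : pc (fun q : I * (A * A) => [/\ D q.1, q.2.1 \in X q.1 & q.2.2 \in X q.1])
  (fun q => m q.1) (fun q => ini q.1 q.2.1 q.2.2).

Lemma pb_item_pairs : pb D m (fun i => size (item_pairs (X i))).
Proof. by apply: pb_le (pb_mul bX bX) _ => i _; rewrite size_item_pairs. Qed.

Lemma pc_option_state :
  pc (fun q : I * seq T => D q.1 /\ q.2 \in flatten (G q.1)) (fun q => m q.1)
     (fun q => option_state (f q.1) (X q.1) q.2).
Proof.
have bs : pb (fun q : I * seq T => D q.1 /\ q.2 \in flatten (G q.1)) (fun q => m q.1) (fun q => size q.2).
  by apply: pb_mono bo _ => q /= [? /InP].
apply: pc_pair; first by apply: pc_size bs; exact: pc_2.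
apply: (pc_map (f := fun q p => separates (f q.1) q.2 p.1 p.2)).
- by apply: pc_wk (pc_item_pairs hX bX) _ => q [].
- by apply: pb_wk pb_item_pairs _ => q [].
apply: (pc_has (f := fun q t => f q.1.1 t q.2.1 (+) f q.1.1 t q.2.2)).
- by apply: pc_snd; exact: pc_1.
- by apply: pb_wk bs _ => q [].
apply: pc_addb.
- apply: (@pc_re _ _ _ _ _ _ _ _ _ (fun q => (q.1.1.1, q.2, q.1.2.1)) _ hf).
    apply: pc_pair; last by apply: pc_fst; apply: pc_snd; exact: pc_1.
    by apply: pc_pair; [do 2!apply: pc_fst; exact: pc_1 | exact: pc_2].
  move=> [[[i o] [x y]] t] /= [[[Di og]]]; rewrite mem_item_pairs => /andP /= [xX yX] to.
  by split=> //; exists o.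
- apply: (@pc_re _ _ _ _ _ _ _ _ _ (fun q => (q.1.1.1, q.2, q.1.2.2)) _ hf).
    apply: pc_pair; last by apply: pc_snd; apply: pc_snd; exact: pc_1.
    by apply: pc_pair; [do 2!apply: pc_fst; exact: pc_1 | exact: pc_2].
  move=> [[[i o] [x y]] t] /= [[[Di og]]]; rewrite mem_item_pairs => /andP /= [xX yX] to.
  by split=> //; exists o.
Qed.

Lemma pc_tabulate : pc D m (fun i => tabulate (f i) (X i) (G i)).
Proof.
apply: (pc_map (f := fun i g => [seq option_state (f i) (X i) o | o <- g])) => //.
apply: (pc_map (f := fun q o => option_state (f q.1) (X q.1) o)).
- exact: pc_2.
- by apply: pb_mono bg _ => q /= [? /InP].
apply: (@pc_re _ _ _ _ _ _ _ _ _ (fun q => (q.1.1, q.2)) _ pc_option_state).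
  by apply: pc_pair; [apply: pc_fst; exact: pc_1 | exact: pc_2].
by move=> [[i g] o] /= [[Di gG] og]; split=> //; apply/flattenP; exists g.
Qed.

Lemma pc_init_state : pc D m (fun i => init_state (ini i) (X i)).
Proof.
apply: (pc_map (f := fun i q => ini i q.1 q.2)).
- exact: pc_item_pairs.
- exact: pb_item_pairs.
by apply: pc_mono hini _ => -[i [x y]] /= [Di]; rewrite mem_item_pairs => /andP [].
Qed.

Lemma choice_bound : exists2 N, pb D m N &
  forall i G1 G2 c, D i -> G i = G1 ++ G2 -> choice G1 c -> size c <= N i.
Proof.
case: bo => b hb; exists (fun i => size (G i) * (b * (m i).+1 ^ b)).
  by apply: pb_mul bG _; exists b.
move=> i G1 G2 c Di e h; apply: (@leq_trans (size G1 * (b * (m i).+1 ^ b))); last first.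
  by rewrite leq_mul2r e size_cat leq_addr orbT.
elim: h G2 e => // {}G1 g {}c o h IH og G2; rewrite cat_rcons => e.
rewrite size_cat size_rcons mulSn addnC leq_add ?(IH (g :: G2)) //.
apply: (hb (i, o)); split=> //=; apply/InP/flattenP; exists g => //.
by rewrite e mem_cat inE eqxx orbT.
Qed.

(** A prefix of the tabulated groups is the tabulation of a prefix, so [size_dp] also bounds every
    intermediate table. The hypothesis [bXX] makes this bound polynomial in the measure. *)
Lemma pc_choice_ok : pc D m (fun i => choice_ok (f i) (ini i) (X i) (K i) (G i)).
Proof.
have [N bN hN] := choice_bound.
have bst : pb (fun q => D q.1 /\ exists l2, tabulate (f q.1) (X q.1) (G q.1) = q.2 ++ l2)
    (fun q => m q.1) (fun q => size (dp (init_state (ini q.1) (X q.1)) q.2)).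
  apply: (@pb_le _ _ _ _ (fun q => (N q.1).+1 * size (X q.1) ^ size (X q.1))).
    apply: (@pb_wk _ _ D _ _ (fun i => (N i).+1 * size (X i) ^ size (X i))); last by move=> q [].
    apply: pb_mul bXX; apply: pb_le (pb_add bN (pb_const _ _ 1)) _ => i _.
    by rewrite addn1.
  move=> [i l1] /= [Di [l2 e]].
  have -> : l1 = tabulate (f i) (X i) (take (size l1) (G i)).
    by rewrite /tabulate map_take [map _ _]e take_size_cat.
  apply: size_dp => c; apply: hN Di _; symmetry; exact: cat_take_drop.
have bcost : pb (fun q => D q.1.1 /\ exists2 l2, tabulate (f q.1.1) (X q.1.1) (G q.1.1) = q.1.2 ++ l2
    & q.2 \in dp (init_state (ini q.1.1) (X q.1.1)) q.1.2)
     (fun q => m q.1.1) (fun q => q.2.1).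
  apply: (@pb_le _ _ _ _ (fun q => N q.1.1)).
    by apply: (@pb_comp _ _ _ _ _ _ _ (fun q => q.1.1) bN) (pb_m _ _) => q [].
  move=> [[i l1] s] /= [Di [l2 e]].
  have -> : l1 = tabulate (f i) (X i) (take (size l1) (G i)).
    by rewrite /tabulate map_take [map _ _]e take_size_cat.
  by case/dpP => c hc -> /=; apply: hN Di _ hc; symmetry; exact: cat_take_drop.
rewrite /choice_ok.
have bdp : pb D m (fun i => size (dp (init_state (ini i) (X i)) (tabulate (f i) (X i) (G i)))).
  case: bst => c hc; exists c => i Di; apply: (hc (i, tabulate (f i) (X i) (G i))).
  by split=> //; exists [::]; rewrite cats0.
apply: (pc_has (f := fun i s => (s.1 <= K i) && all id s.2)) bdp _.
  apply: pc_dp bst bcost.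
  - exact: pc_init_state.
  - by apply: pb_le pb_item_pairs _ => i _; rewrite size_map.
  - exact: pc_tabulate.
  - by apply: pb_le bG _ => i _; rewrite size_map.
  - case: bg => c hc; exists c => -[i g] /= [Di /InP /mapP [g' /InP gG ->]].
    by rewrite size_map; apply: (hc (i, g')).
  - case: bo => c hc; exists c => -[i g] /= [Di /InP /flatten_mapP [g' gG /mapP [o og ->]]].
    by apply: (hc (i, o)); split=> //; apply/InP/flattenP; exists g'.
apply: pc_andb.
  apply: pc_leq; first by apply: pc_fst; exact: pc_2.
    by apply: pc_wk hK _ => q [].
  by apply: pb_wk bK _ => q [].
apply: (pc_all (f := fun _ => id)); first by apply: pc_snd; exact: pc_2.
  apply: (@pb_le _ _ _ _ (fun q => size (item_pairs (X q.1)))).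
    by apply: pb_wk pb_item_pairs _ => q [[]].
  by move=> [i s] /= [[_ /dp_size ->] _]; rewrite size_map.
exact: pc_2.
Qed.

End PcChoice.

(** * Enumeration of subsets and reading of binary budgets *)

Fixpoint sublists (A : Type) (s : seq A) : seq (seq A) :=
  if s is x :: s' then sublists s' ++ [seq x :: t | t <- sublists s'] else [:: [::]].

Lemma size_sublists (A : Type) (s : seq A) : size (sublists s) = 2 ^ size s.
Proof. by elim: s => //= x s IH; rewrite size_cat size_map IH addnn expnS mul2n. Qed.

Lemma sublists_subseq (A : eqType) (s t : seq A) : t \in sublists s -> subseq t s.
Proof.
elim: s t => [|x s IH] t /=; first by rewrite inE => /eqP ->.
rewrite mem_cat => /orP [/IH h|/mapP [u /IH h ->]]; last by rewrite /= eqxx.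
exact: subseq_trans h (subseq_cons _ _).
Qed.

Lemma filter_sublists (A : eqType) (p : pred A) (s : seq A) : filter p s \in sublists s.
Proof.
elim: s => //= x s IH; rewrite mem_cat; case: (p x); rewrite ?IH //.
by rewrite map_f ?orbT.
Qed.

Lemma pc_sublists I {cI : code I} (D : I -> Prop) m (A : eqType) {cA : code A} (s : I -> seq A) :
  pc D m s -> pb D m (fun i => size (s i)) -> pb D m (fun i => 2 ^ size (s i)) ->
  pc D m (fun i => sublists (s i)).
Proof.
move=> hs bs b2.
have E t : sublists t = foldr (fun (x : A) r => r ++ [seq x :: u | u <- r]) [:: [::]] t.
  by elim: t => //= x t ->.
apply: (@pc_ext _ _ _ _ _ _ (fun i => foldr (fun (x : A) r => r ++ [seq x :: u | u <- r]) [:: [::]] (s i)));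
  last by move=> i _; rewrite E.
apply: (pc_foldr (f := fun _ (x : A) r => r ++ [seq x :: u | u <- r])) => //.
  by apply: pc_cons; exact: pc_nil.
have hr D' m' : pc D' m' (fun q : I * seq (seq A) * A => q.1.2) by apply: pc_snd; exact: pc_1.
have br : pb (fun q : I * seq (seq A) * A => D q.1.1 /\ (exists l1 l2, s q.1.1 = l1 ++ q.2 :: l2 /\
     q.1.2 = foldr (fun (x : A) r => r ++ [seq x :: u | u <- r]) [:: [::]] l2)) (fun q => m q.1.1)
     (fun q => size q.1.2).
  case: b2 => c hc; exists c => -[[i r] x] /= [Di [l1 [l2 [e ->]]]].
  rewrite -E size_sublists; apply: leq_trans (hc i Di).
  by rewrite leq_exp2l // e size_cat /=; lia.
apply: pc_cat => //; apply: (pc_map (f := fun q u => q.2 :: u)) => //.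
by apply: pc_cons; [apply: pc_snd; exact: pc_1 | exact: pc_2].
Qed.

(* The minimum of [n] and of the number with binary expansion [bits], read off
   at most [n + 1] of its bits. *)
Definition cap (n : nat) (bits : seq bool) : nat :=
  if nilp (drop n bits) then
    foldr (fun (b : bool) v => minn n (v + v + b)) 0 [seq nth false bits j | j <- iota 0 n]
  else n.

Definition bits_of (k : nat) := mkseq (fun i => odd (k %/ 2 ^ i)) (up_log 2 k.+1).

Lemma enc_bits_of k : enc (bits_of k) = code_nat k.
Proof. by rewrite /code_nat /bits_of /enc /code_list /mkseq -map_comp. Qed.

Lemma pc_cap I {cI : code I} (D : I -> Prop) m (n : I -> nat) (b : I -> seq bool) :
  pc D m n -> pb D m n -> pc D m b -> pc D m (fun i => cap (n i) (b i)).
Proof.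
move=> hn bn hb; apply: pc_if; first by apply: pc_nilp; apply: pc_drop.
  have hl : pc D m (fun i => [seq nth false (b i) j | j <- iota 0 (n i)]).
    apply: (pc_map (f := fun i j => nth false (b i) j)); first exact: pc_iota.
      by apply: pb_le bn _ => i _; rewrite size_iota.
    apply: pc_nth; [exact: pc_2 | | exact: pc_false | ]; last by apply: pc_wk hb _ => q [].
    apply: (@pb_le _ _ _ _ (fun q => n q.1)); first by apply: pb_wk bn _ => q [].
    by move=> q [_]; rewrite mem_iota => /andP [_ /ltnW].
  apply: pc_mono (_ : pc D m _) _; last by move=> i [].
  apply: (pc_foldr (f := fun i (b : bool) v => minn (n i) (v + v + b)) _ hl).
  - exact: pc_zero.
  - by apply: pb_le bn _ => i _; rewrite size_map size_iota.
  have hv D' m' : pc D' m' (fun q : I * nat * bool => q.1.2) by apply: pc_snd; exact: pc_1.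
  set D' := fun q : I * nat * bool => _; set m' := fun q : I * nat * bool => _.
  have bn' : pb D' m' (fun q => n q.1.1).
    by apply: (@pb_comp _ _ _ _ _ _ _ (fun q : I * nat * bool => q.1.1) bn) (pb_m _ _) => q [].
  (* Capping after every bit keeps the accumulator at most [n], so it can be held in unary. *)
  have bv : pb D' m' (fun q => q.1.2).
    apply: pb_le bn' _ => -[[i v] a] [Di [l1 [l2 [_ /= ->]]]].
    by case: l2 => //= *; apply: geq_minl.
  have ha : pc D' m' (fun q => nat_of_bool q.2).
    apply: (@pc_ext _ _ _ _ _ _ (fun q => if q.2 then 1 else 0)).
      by apply: pc_if; [exact: pc_2 | exact: pc_const | exact: pc_const].
    by move=> [q []].
  have ba : pb D' m' (fun q => nat_of_bool q.2).
    by apply: pb_le (pb_const _ _ 1) _ => -[q []].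
  apply: pc_minn => //.
  - by apply: (@pc_re _ _ _ _ _ _ _ _ _ (fun q : I * nat * bool => q.1.1) _ hn);
      [exact: pc_fst (pc_1 _ _) | move=> q []].
  - by apply: pc_add => //; apply: pc_add.
  - by apply: pb_add => //; apply: pb_add.
by apply: pc_mono hn _ => i [].
Qed.

(** [bits_of] has no leading zeros, so more than [n] bits mean k >= 2^n > n. Otherwise Horner's rule
    runs over all bits, and capping commutes with its step: min(n, 2 min(n, w) + b) = min(n, 2w +
    b). *)
Lemma capE n k : cap n (bits_of k) = minn n k.
Proof.
rewrite /cap /nilp size_drop size_mkseq subn_eq0; case: ltnP => h.
  have kn : 2 ^ n <= k by rewrite leqNgt; apply: contraL h; rewrite -leqNgt; apply: up_log_min.
  by have := ltn_expl n (isT : 1 < 2); lia.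
have {h} kn : k < 2 ^ n by apply: leq_trans (up_logP _ (isT : 1 < 2)) _; rewrite leq_exp2l.
have H j l : j + l = n -> foldr (fun (b : bool) v => minn n (v + v + b)) 0
   [seq nth false (bits_of k) i | i <- iota j l] = minn n (k %/ 2 ^ j).
  elim: l j => [|l IH] j e /=; first by rewrite divn_small ?minn0 //; move: kn; rewrite -e addn0.
  rewrite IH ?addSnnS // (_ : nth _ _ _ = odd (k %/ 2 ^ j)).
    rewrite expnSr divnMA divn2; have := odd_double_half (k %/ 2 ^ j).
    by rewrite -addnn; case: (odd _) => /=; lia.
  rewrite /bits_of; case: (ltnP j (up_log 2 k.+1)) => lj; first by rewrite nth_mkseq.
  rewrite nth_default ?size_mkseq // divn_small //.
  by apply: leq_trans (up_logP _ (isT : 1 < 2)) _; rewrite leq_exp2l.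
by rewrite H // divn1.
Qed.

(** * Test Cover *)

(** A polynomial in 2^f * (size + 1) is of the required form, because raising 2^f to the power [c]
    only puts the factor [c] into the exponent. The factor 2^c in the new constant absorbs the
    successor in the definition of [pc]. *)
Lemma pc_solvable (I : Type) (cI : code I) (yes : I -> bool) (f size : I -> nat) :
  pc (fun _ => True) (fun x => 2 ^ f x * (size x).+1) yes ->
  solvable_in_time cI yes f size.
Proof.
move=> [P [c h]]; exists P, (c * 2 ^ c + c) => x; have [t ev le] := h x Logic.I.
exists t => //; apply: leq_trans le _.
have: c * (2 ^ f x * (size x).+1).+1 ^ c <= c * (2 * (2 ^ f x * (size x).+1)) ^ c.
  have: (2 ^ f x * (size x).+1).+1 <= 2 * (2 ^ f x * (size x).+1).
    by rewrite mul2n -addnn -addn1 leq_add2l muln_gt0 expn_gt0.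
  by move=> ?; rewrite leq_mul2l; case: (c) => // k; rewrite leq_exp2r ?orbT.
move=> h1; apply: leq_trans h1 _; rewrite !expnMn -expnM mulnA.
rewrite mulnA leq_mul //.
  rewrite leq_mul ?leq_addr // leq_exp2l // mulnC leq_mul2r leq_addl orbT //.
by rewrite leq_pexp2l // leq_addl.
Qed.

(** With t the rounded-down logarithm, x < 2^(t+1), and t + 1 <= 2t once x >= 2; this gives the
    exponent 2. *)
Lemma expnn_nlogn x : x ^ x <= (2 ^ nlogn x) ^ 2.
Proof.
case: x => [|[|x]] //; set n := x.+2; rewrite -expnM /nlogn.
apply: (@leq_trans ((2 ^ (trunc_log 2 n).+1) ^ n)).
  by rewrite leq_exp2r // ltnW // trunc_log_ltn.
rewrite -expnM leq_exp2l // mulnC -mulnA leq_mul2l.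
by have : 0 < trunc_log 2 n; [rewrite trunc_log_gt0|lia].
Qed.

(** Sizes of candidate solutions never exceed [N], so comparing them with the capped budget gives
    the same answer. The sign is tested separately. *)
Lemma budgetE (z : int) (N a : nat) : a <= N ->
  (a%:Z <= z)%R = ~~ (z < 0)%R && (a <= cap N (bits_of `|z|%N)).
Proof. by rewrite capE; lia. Qed.

Lemma choice_skip (T : eqType) (s c : seq T) :
  choice [seq [:: [::]; [:: t]] | t <- s] c -> subseq c s.
Proof.
elim/last_ind: s c => [|s t IH] c; first by move/choice_nil ->.
rewrite map_rcons => /choice_rcons [c' [o [/IH h]]]; rewrite !inE => /orP [] /eqP -> ->.
  by rewrite cats0; apply: subseq_trans h (subseq_rcons _ _).
by rewrite cats1 -!cats1; apply: cat_subseq.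
Qed.

Lemma choice_filter (T : eqType) (p : pred T) (s : seq T) :
  choice [seq [:: [::]; [:: t]] | t <- s] (filter p s).
Proof.
elim/last_ind: s => [|s t IH]; first exact: Choice0.
rewrite map_rcons filter_rcons; case: (p t).
  by rewrite -(cats1 (filter p s)); apply: ChoiceS; rewrite // !inE eqxx orbT.
by rewrite -[filter _ _]cats0; apply: ChoiceS; rewrite // inE eqxx.
Qed.

Section CharacteristicVector.
Variable n : nat.

Definition char_vec (T : {set 'I_n}) : seq bool := [seq i \in T | i <- enum 'I_n].

Lemma nth_char_vec T (i : 'I_n) : nth false (char_vec T) i = (i \in T).
Proof. by rewrite (nth_map i) ?size_enum_ord // nth_ord_enum. Qed.

Lemma char_vec_inj : injective char_vec.
Proof. by move=> S T e; apply/setP => i; rewrite -!nth_char_vec e. Qed.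

End CharacteristicVector.

#[local] Instance code_tc' : code tc_instance := code_tc.

Definition tc_tests (x : tc_instance) : seq (seq bool) := [seq char_vec T | T <- tests x].

Definition tc_cap (x : tc_instance) := cap (size (tests x)) (bits_of `|tc_budget x|%N).

Definition tc_solve (x : tc_instance) : bool :=
  ~~ (tc_budget x < 0)%R &&
  choice_ok (fun T i => nth false T i) eq_op (iota 0 (items x)) (tc_cap x)
    [seq [:: [::]; [:: T]] | T <- tc_tests x].

Lemma tcE x : tc x = tc_solve x.
Proof.
(* Distinct tests have distinct characteristic vectors, so the size of a choice can be compared with
   the number of tests it represents. *)
have us : uniq (tc_tests x) by rewrite map_inj_uniq ?tests_uniq //; apply: char_vec_inj.
have szt : size (tc_tests x) = size (tests x) by rewrite size_map.
apply/existsP/andP.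
  case=> C /and3P [/subsetP Cs cov].
  have Csz : #|C| <= size (tests x).
    by rewrite cardE; apply: uniq_leq_size; [apply: enum_uniq | move=> T; rewrite mem_enum; apply: Cs].
  rewrite (budgetE _ Csz) => /andP [-> CK]; split=> //; apply/choice_okP.
  exists (filter (fun v => v \in [seq char_vec T | T <- enum C]) (tc_tests x)).
  split; first exact: choice_filter.
    apply: leq_trans CK; rewrite cardE -(size_map (@char_vec _)).
    by apply: uniq_leq_size; [apply: filter_uniq | move=> v; rewrite mem_filter => /andP []].
  move=> i j; rewrite !mem_iota !add0n => /= li lj; rewrite -implyNb; apply/implyP => ne.
  have /forallP /(_ (Ordinal li)) /forallP /(_ (Ordinal lj)) := cov.
  rewrite -val_eqE /= ne => /existsP [T /andP [TC sep]].
  apply/hasP; exists (char_vec T).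
    by rewrite mem_filter !map_f ?mem_enum // Cs.
  by rewrite -(nth_char_vec T (Ordinal li)) -(nth_char_vec T (Ordinal lj)) in sep.
case=> z0 /choice_okP [c [/choice_skip sub cK sep]].
have uc := subseq_uniq sub us.
pose C : {set {set 'I_(items x)}} := [set T in tests x | char_vec T \in c].
have Csz : #|C| <= size c.
  rewrite cardE -(size_map (@char_vec _)); apply: uniq_leq_size.
    by rewrite map_inj_uniq ?enum_uniq //; apply: char_vec_inj.
  by move=> v /mapP [T]; rewrite mem_enum inE => /andP [_ h] ->.
exists C; apply/and3P; split.
- by apply/subsetP => T; rewrite inE => /andP [].
- apply/forallP => i; apply/forallP => j; apply/implyP => ne.
  have := sep i j; rewrite !mem_iota !add0n /= !ltn_ord => /(_ isT isT).
  rewrite val_eqE (negbTE ne) => /hasP [v vc sv]; apply/existsP.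
  have /mapP [T Tt e] := mem_subseq sub vc.
  by exists T; rewrite e !nth_char_vec in sv vc *; rewrite inE Tt vc.
- rewrite (@budgetE _ (size (tests x))) ?z0 /=.
    exact: leq_trans Csz cK.
  by apply: leq_trans Csz _; rewrite -szt; apply: size_subseq.
Qed.

Lemma enc_map (A B : Type) {cB : code B} (f : A -> B) (s : seq A) :
  enc [seq f a | a <- s] = code_seq [seq enc (f a) | a <- s].
Proof. by rewrite {1}/enc /code_list -map_comp. Qed.

Lemma test_cover_solvable :
  solvable_in_time code_tc tc (fun x => nlogn (items x)) (fun x => items x + size (tests x)).
Proof.
apply: pc_solvable; set D := (X in pc X); set m := (X in pc _ X).
have hm x : items x + size (tests x) < m x.
  by rewrite /m leq_pmull // expn_gt0.
have [b1 b2] : pb D m items /\ pb D m (fun x => size (tests x)).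
  by split; apply: pb_le (pb_m _ _) _ => x _; have := hm x; lia.
have p1 : pc D m items.
  by apply: (@pc_projl _ _ _ tree _ _ _ id _ _ id) (pc_id _ _) => x _.
(* The code of an instance is also the code of the nested pair of [items], the vectors, the sign and
   the bits; the parts are therefore available by projection. *)
have bits : pc D m (fun x : tc_instance => (tc_tests x, ((tc_budget x < 0)%R, bits_of `|tc_budget x|%N))).
  apply: (@pc_projr _ _ nat _ _ _ _ _ _ _ id items) (pc_id _ _) => x _ /=.
  rewrite {1}/enc /code_tc' /code_tc; congr (Node _ (Node _ _)).
    by rewrite enc_map; congr code_seq; apply: eq_map => T; rewrite enc_map.
  by rewrite /code_int -enc_bits_of.
have p2 : pc D m tc_tests := pc_fst bits.
have b2' : pb D m (fun x => size (tc_tests x)) by apply: pb_le b2 _ => x _; rewrite size_map.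
have p2' : pc D m (fun x => size (tests x)).
  by apply: pc_ext (pc_size p2 b2') _ => x _; rewrite size_map.
have p3 : pc D m (fun x => (tc_budget x < 0)%R) := pc_fst (pc_snd bits).
have p4 : pc D m (fun x => bits_of `|tc_budget x|%N) := pc_snd (pc_snd bits).
apply: (@pc_ext _ _ _ _ _ _ tc_solve); last by move=> x _; rewrite tcE.
apply: pc_andb; first exact: pc_negb.
apply: pc_mono (_ : pc D m _) _ => //.
apply: (pc_choice_ok (f := fun _ T i => nth false T i) (ini := fun _ => eq_op)).
- exact: pc_iota.
- by apply: pb_le b1 _ => x _; rewrite size_iota.
- apply: (@pb_le _ _ _ _ (fun x => m x ^ 2)); first by apply: pb_exp; apply: pb_m.
  by move=> x _; rewrite size_iota (leq_trans (expnn_nlogn _)) // leq_exp2r // leq_pmulr.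
- apply: (pc_map (f := fun _ T => [:: [::]; [:: T]])) => //.
  apply: pc_cons; first exact: pc_nil.
  by do 2!(apply: pc_cons; last exact: pc_nil); exact: pc_2.
- by apply: pb_le b2' _ => x _; rewrite size_map.
- by apply: pb_le (pb_const _ _ 2) _ => -[x g] /= [_ /InP /mapP [T _ ->]].
- apply: pb_le (pb_const _ _ 1) _ => -[x g] /= [_ /InP /flatten_mapP [T _]].
  by rewrite !inE => /orP [] /eqP ->.
- exact: pc_cap.
- by apply: pb_le b2 _ => x _; rewrite /tc_cap capE geq_minl.
- apply: pc_nth; [exact: pc_2 | | exact: pc_false | by apply: pc_snd; exact: pc_1].
  apply: (@pb_le _ _ _ _ (fun q => items q.1.1)).
    by apply: (@pb_comp _ _ _ _ _ _ _ (fun q => q.1.1) b1) (pb_m _ _).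
  by move=> q [_ _]; rewrite mem_iota => /andP [_ /ltnW].
- have bi (g : tc_instance * (nat * nat) -> nat) :
      (forall q, [/\ D q.1, q.2.1 \in iota 0 (items q.1) & q.2.2 \in iota 0 (items q.1)] ->
         g q \in iota 0 (items q.1)) ->
    pb (fun q => [/\ D q.1, q.2.1 \in iota 0 (items q.1) & q.2.2 \in iota 0 (items q.1)]) (fun q => m q.1) g.
    move=> hg; apply: (@pb_le _ _ _ _ (fun q => items q.1)); first by apply: pb_wk b1 _.
    by move=> q /hg; rewrite mem_iota => /andP [_ /ltnW].
  apply: pc_eqn; [apply: pc_fst; exact: pc_2 | apply: pc_snd; exact: pc_2 | |];
    by apply: bi => q [].
Qed.

(** * Locating-Dominating Set *)

Section GreedyCover.
Variables (a : nat -> nat -> bool).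
Hypothesis airr : forall u, a u u = false.

Definition cover_step (U : seq nat) (p : nat * nat) : seq nat :=
  if [&& a p.1 p.2, p.1 \notin U & p.2 \notin U] then [:: p.1, p.2 & U] else U.

Definition greedy_cover (n : nat) : seq nat := foldl cover_step [::] (item_pairs (iota 0 n)).

(** Whenever [U] grows it receives both ends of an edge, of which every vertex cover contains at
    least one; this gives the factor 2. The statement concerns an arbitrary list of pairs because
    the running time of the loop needs it for prefixes. *)
Lemma cover_stepsP ps (U := foldl cover_step [::] ps) :
  [/\ uniq U, size U <= 2 * size ps,
      forall u, u \in U -> exists2 p, p \in ps & (u == p.1) || (u == p.2),
      forall p, p \in ps -> a p.1 p.2 -> (p.1 \in U) || (p.2 \in U) &
      forall C : pred nat, (forall u v, a u v -> C u || C v) -> size U <= 2 * count C U].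
Proof.
rewrite {}/U; elim/last_ind: ps => // ps p [IHu IHs IHm IHc IHC].
rewrite foldl_rcons; set U := foldl _ _ _ in IHu IHs IHm IHc IHC *.
rewrite /cover_step; case: ifP => [/and3P [ap p1 p2]|np].
  split.
  - rewrite /= inE negb_or p1 p2 IHu !andbT; apply: contraTneq ap => ->.
    by rewrite airr.
  - by rewrite size_rcons /=; lia.
  - move=> u; rewrite !inE => /or3P [e|e|/IHm [q qp e]].
    + by exists p; rewrite ?mem_rcons ?inE ?eqxx ?e.
    + by exists p; rewrite ?mem_rcons ?inE ?eqxx ?e ?orbT.
    + by exists q; rewrite // mem_rcons inE qp orbT.
  - move=> q; rewrite mem_rcons !inE => /orP [/eqP ->|qp aq]; first by rewrite eqxx.
    by case/orP: (IHc q qp aq) => ->; rewrite !orbT.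
  - move=> C hC; have := IHC C hC; have := hC _ _ ap; rewrite /=.
    by case: (C p.1); case: (C p.2) => //=; lia.
split=> //.
- by rewrite size_rcons; lia.
- by move=> u /IHm [q qp e]; exists q; rewrite // mem_rcons inE qp orbT.
- move=> q; rewrite mem_rcons inE => /orP [/eqP -> ap|]; last exact: IHc.
  by move: np; rewrite ap /= -negb_or => /negbFE.
Qed.

End GreedyCover.

(** * Reduction to the choice problem for a fixed guess *)

Section LocatingDomination.
Variables (a : nat -> nat -> bool) (n : nat).
Hypothesis alt : forall u v, a u v -> u < n.

(* The items are the vertices and one item [n] that no vertex is adjacent to;
   separating it from a vertex amounts to dominating that vertex. *)
Definition touches (t x : nat) : bool := a x t.

Definition ld (S : seq nat) : Prop := forall u v, u < n -> v <= n -> u != v ->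
  u \notin S -> v \notin S -> separates touches S u v.

Lemma no_nbh t : a n t = false.
Proof. by apply/negP => /alt; rewrite ltnn. Qed.

Lemma separatesC (c : seq nat) x y : separates touches c x y = separates touches c y x.
Proof. by apply: eq_has => t; rewrite addbC. Qed.

Lemma separates_n (c : seq nat) x : separates touches c x n = has (a x) c.
Proof. by apply: eq_has => t; rewrite /touches no_nbh addbF. Qed.

Variable U : seq nat.
Hypothesis Uu : uniq U.
Hypothesis Un : forall u, u \in U -> u < n.
Hypothesis Uc : forall u v, a u v -> (u \in U) || (v \in U).

Definition rest : seq nat := [seq w <- iota 0 n | w \notin U].

Lemma mem_rest w : (w \in rest) = (w < n) && (w \notin U).
Proof. by rewrite mem_filter mem_iota add0n andbC. Qed.

Lemma rest_indep v w : v \in rest -> w \in rest -> a v w = false.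
Proof.
rewrite !mem_rest => /andP [_ /negbTE vU] /andP [_ /negbTE wU].
by apply/negP => /Uc; rewrite vU wU.
Qed.

(* A guess: [Y] is the set of vertices of [U] in the solution, and [Z] is the
   set of vertices of [U] that a vertex of the solution outside [U] dominates. *)
Variables Y Z : seq nat.

Definition signature (x : nat) : seq bool := [seq a x y | y <- Y].

Lemma signatureE x y : (signature x == signature y) = ~~ separates touches Y x y.
Proof.
apply/eqP/hasPn => [/eq_in_map h t tY|h]; first by rewrite negb_add; apply/eqP/h.
by apply/eq_in_map => t /h; rewrite negb_add => /eqP.
Qed.

(** For the correct guess these vertices lie outside the solution and have all their neighbours in
    the solution in [Y]. *)
Definition free : seq nat := [seq u <- U | (u \notin Y) && (u \notin Z)].

(** The conditions for leaving [z] in [rest] out. Its neighbours lie in [U], so [Y] has to dominate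
    it. A vertex of [free] is seen from [Y] only, like [z], so their signatures must differ. A
    vertex of [Z] is told apart from [z] by its neighbour in the solution outside [U]. *)
Definition allowed (z : nat) : bool :=
  has (a z) Y && ~~ has (fun u => signature u == signature z) free.

Definition class (g : seq bool) : seq nat := [seq w <- rest | signature w == g].

Definition options (g : seq bool) : seq (seq nat) :=
  class g :: [seq [seq w <- class g | w != z] | z <- [seq z <- class g | allowed z]].

Definition signatures : seq (seq bool) := undup [seq signature w | w <- rest].

Definition groups : seq (seq (seq nat)) := [seq options g | g <- signatures].

(* The pairs that vertices of the solution outside [U] need not separate. *)
Definition settled (x y : nat) : bool :=
  [|| x == y, x \in Y, y \in Y, x == n |
      if y == n then x \notin Z else separates touches Y x y].

(** The test [size Y <= K] protects the truncated subtraction in the remaining budget. *)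
Definition check (K : nat) : bool :=
  [&& all (fun u => has (a u) Y) free, size Y <= K &
      choice_ok touches settled (n :: U) (K - size Y) groups].

Lemma class_uniq g : uniq (class g).
Proof. by rewrite !filter_uniq ?iota_uniq. Qed.

Lemma mem_options g o : o \in options g -> [/\ uniq o, {subset o <= class g},
  forall w, w \in class g -> w \notin o -> allowed w &
  forall v w, v \in class g -> w \in class g -> v \notin o -> w \notin o -> v = w].
Proof.
rewrite inE => /orP [/eqP ->|/mapP [z]].
  split=> //; first exact: class_uniq.
  - by move=> w ->.
  - by move=> v w ->.
rewrite mem_filter => /andP [az zg] ->; split.
- by rewrite filter_uniq // class_uniq.
- by move=> w; rewrite mem_filter => /andP [].
- by move=> w wg; rewrite mem_filter wg andbT negbK => /eqP ->.
- by move=> v w vg wg; rewrite [v \in _]mem_filter [w \in _]mem_filter vg wg !andbT !negbK => /eqP -> /eqP ->.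
Qed.

Lemma mem_class g w : (w \in class g) = (w \in rest) && (signature w == g).
Proof. by rewrite mem_filter andbC. Qed.

(** Classes of different signatures are disjoint, so the chosen options do not overlap, and two
    omitted vertices with the same signature were omitted by the same option. The list [gs] of
    signatures is arbitrary for the sake of the induction. *)
Lemma choice_options gs c : uniq gs -> choice [seq options g | g <- gs] c ->
  [/\ uniq c, forall w, w \in c -> (w \in rest) && (signature w \in gs),
   forall w, w \in rest -> signature w \in gs -> w \notin c -> allowed w &
   forall v w, v \in rest -> w \in rest -> signature v \in gs ->
     signature v = signature w -> v \notin c -> w \notin c -> v = w].
Proof.
elim/last_ind: gs c => [|gs g IH] c; first by move=> _ /choice_nil ->.
rewrite rcons_uniq map_rcons => /andP [ggs us] /choice_rcons [c' [o [hc og ->]]].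
have [uo so ao io] := mem_options og; have [uc sc ac ic] := IH _ us hc.
split.
- rewrite cat_uniq uc uo andbT /=; apply/hasPn => w /so; rewrite mem_class => /andP [_ /eqP e].
  by apply: contra ggs => /sc /andP []; rewrite e.
- move=> w; rewrite mem_cat mem_rcons inE => /orP [/sc /andP [-> ->]|/so]; first by rewrite orbT.
  by rewrite mem_class => /andP [-> ->].
- move=> w wr; rewrite mem_rcons inE mem_cat negb_or => /orP [e|wgs] /andP [wc wo].
    by apply: ao wo; rewrite mem_class wr.
  exact: ac.
- move=> v w vr wr; rewrite mem_rcons inE !mem_cat !negb_or.
  move=> /orP [e|vgs] evw /andP [vc vo] /andP [wc wo].
    by apply: io => //; rewrite mem_class ?vr ?wr -?evw.
  exact: ic.
Qed.

Lemma choice_groups c : choice groups c ->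
  [/\ uniq c, {subset c <= rest}, forall w, w \in rest -> w \notin c -> allowed w &
   forall v w, v \in rest -> w \in rest -> signature v = signature w ->
     v \notin c -> w \notin c -> v = w].
Proof.
move=> /(choice_options (undup_uniq _)) [uc sc ac ic].
have ms w : w \in rest -> signature w \in signatures by move=> wr; rewrite mem_undup map_f.
split=> //.
- by move=> w /sc /andP [].
- by move=> w wr; apply: ac => //; apply: ms.
- by move=> v w vr wr; apply: ic => //; apply: ms.
Qed.

(** Every guess that passes gives a solution, namely [Y] with the choice [c]. For [u] in [Z] outside
    [Y], the item [n] forces a neighbour of [u] in [c]; for the other vertices of [U] outside [Y],
    domination and separation from [rest] are already achieved by [Y]. *)
Lemma check_sound K : uniq Y -> {subset Y <= U} -> check K ->
  exists S, [/\ uniq S, forall u, u \in S -> u < n, ld S & size S <= K].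
Proof.
move=> uY YU /and3P [/allP dom YK /choice_okP [c [hc cK sep]]].
have [uc cr ac ic] := choice_groups hc.
exists (Y ++ c); split.
- rewrite cat_uniq uY uc andbT; apply/hasPn => w /cr; rewrite mem_rest => /andP [_].
  by apply: contra; apply: YU.
- by move=> u; rewrite mem_cat => /orP [/YU /Un|/cr] //; rewrite mem_rest => /andP [].
- have sepc (x y : nat) : separates touches (Y ++ c) x y = separates touches Y x y || separates touches c x y.
    exact: has_cat.
  (* If [u] is in [Z], a neighbour of [u] in [c] separates the pair, since it is not adjacent to [v]
     in the independent set [rest]. Otherwise [u] is in [free] and [allowed v] makes the signatures
     differ. *)
  have UR u v : u \in U -> v \in rest -> u \notin Y -> v \notin c -> separates touches (Y ++ c) u v.
    move=> uU vr uY' vc; rewrite sepc; case uZ: (u \in Z).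
      have := sep u n; rewrite !inE eqxx uU orbT /settled (negbTE uY') uZ (ltn_eqF (Un uU)).
      have -> : (n \in Y) = false by apply/negP => /YU /Un; rewrite ltnn.
      rewrite eqxx /= separates_n => /(_ isT isT) /hasP [t tc aut].
      apply/orP; right; apply/hasP; exists t => //.
      by rewrite /touches aut (rest_indep vr (cr _ tc)).
    have /andP [_ /hasPn /(_ u)] := ac v vr vc.
    by rewrite mem_filter uU uY' uZ signatureE negbK => /(_ isT) ->.
  move=> u v lu lv ne; rewrite !mem_cat !negb_or => /andP [uY' uc'] /andP [vY vc].
  have vcase : [\/ v \in U, v \in rest | v = n].
    case: (ltngtP v n) lv => // [lv|->] _; last by constructor 3.
    case vU: (v \in U); first by constructor 1.
    by constructor 2; rewrite mem_rest lv vU.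
  case uU: (u \in U).
    case: vcase => [vU|vr|->]; [|exact: UR|].
      have := sep u v; rewrite !inE uU vU !orbT /settled (negbTE ne) (negbTE uY') (negbTE vY).
      by rewrite (ltn_eqF (Un uU)) (ltn_eqF (Un vU)) /= sepc; apply.
    rewrite separates_n has_cat; case uZ: (u \in Z).
      have := sep u n; rewrite !inE eqxx uU orbT /settled (negbTE uY') uZ (ltn_eqF (Un uU)).
      have -> : (n \in Y) = false by apply/negP => /YU /Un; rewrite ltnn.
      by rewrite eqxx /= separates_n => /(_ isT isT) ->; rewrite orbT.
    by rewrite dom // mem_filter uU uY' uZ.
  have ur : u \in rest by rewrite mem_rest lu uU.
  case: vcase => [vU|vr|->].
  - by rewrite separatesC; apply: UR.
  - rewrite sepc; apply/orP; left; rewrite -[separates _ _ _ _]negbK -signatureE.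
    by apply: contra ne => /eqP e; apply/eqP; apply: ic.
  - by rewrite separates_n has_cat; case/andP: (ac u ur uc') => ->.
- by rewrite size_cat -leq_subRL.
Qed.

End LocatingDomination.

Section Completeness.
Variables (a : nat -> nat -> bool) (n : nat) (U S : seq nat).
Hypothesis alt : forall u v, a u v -> u < n.
Hypothesis Uu : uniq U.
Hypothesis Un : forall u, u \in U -> u < n.
Hypothesis Uc : forall u v, a u v -> (u \in U) || (v \in U).
Hypothesis Sn : forall u, u \in S -> u < n.
Hypothesis hS : ld a n S.

Let X := [seq w <- rest n U | w \in S].
Let Y := [seq u <- U | u \in S].
Let Z := [seq u <- U | has (a u) X].

Lemma mem_solution s : s \in S -> (s \in Y) || (s \in X).
Proof.
move=> sS; rewrite [s \in Y]mem_filter [s \in X]mem_filter sS mem_rest Sn //=.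
by case: (s \in U).
Qed.

Lemma XS s : s \in X -> s \in rest n U. Proof. by rewrite mem_filter => /andP []. Qed.

(** Two vertices of one class outside [S] agree on [Y] and have no neighbours in [X], so nothing in
    [S] would separate them: at most one is missing. Independence of [rest] likewise shows that only
    [Y] can dominate the missing vertex or tell it apart from a vertex of [free], which makes it
    allowed. *)
Lemma solution_option g :
  [seq w <- class a n U Y g | w \in S] \in options a n U Y Z g.
Proof.
rewrite inE; case: (boolP (all (mem S) (class a n U Y g))) => [/all_filterP ->|].
  by rewrite eqxx.
case/allPn => z zg zS; apply/orP; right; apply/mapP; exists z; last first.
  apply: eq_in_filter => w wg; case: eqP => [->|/eqP ne] /=; first exact: negbTE.
  apply/negPn/negP => wS; move: zg wg; rewrite !mem_class => /andP [zr /eqP ez] /andP [wr /eqP ew].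
  have [lz lw] : z < n /\ w < n by move: zr wr; rewrite !mem_rest => /andP [-> _] /andP [-> _].
  have : signature a Y z == signature a Y w by rewrite ez ew.
  rewrite signatureE => /hasPn h.
  have /hasP [s sS sep] := hS lz (ltnW lw) (introN eqP (not_eq_sym (elimN eqP ne))) zS wS.
  case/orP: (mem_solution sS) => [/h|/XS sr]; first by rewrite sep.
  by move: sep; rewrite /touches (rest_indep Uc zr sr) (rest_indep Uc wr sr).
rewrite mem_filter zg andbT; move: zg; rewrite mem_class => /andP [zr _].
have lz : z < n by move: zr; rewrite mem_rest => /andP [].
have nS : n \notin S by apply/negP => /Sn; rewrite ltnn.
apply/andP; split.
  have := hS lz (leqnn n) (negbT (ltn_eqF lz)) zS nS; rewrite separates_n // => /hasP [s sS azs].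
  apply/hasP; exists s => //; case/orP: (mem_solution sS) => // /XS sr.
  by rewrite (rest_indep Uc zr sr) in azs.
apply/hasPn => u; rewrite mem_filter => /andP [/andP [uY uZ] uU].
have uS : u \notin S by apply: contra uY => uS; rewrite mem_filter uS.
have ne : u != z by apply: contraTneq uU => ->; move: zr; rewrite mem_rest => /andP [].
rewrite signatureE negbK; have /hasP [s sS sep] := hS (Un uU) (ltnW lz) ne uS zS.
case/orP: (mem_solution sS) => [sY|sX]; first by apply/hasP; exists s.
move: sep; rewrite /touches (rest_indep Uc zr (XS sX)) addbF => aus.
by move: uZ; rewrite mem_filter uU andbT => /hasPn /(_ s sX); rewrite aus.
Qed.

(** The choice [c] is the solution cut along the classes, so it contains [X] and lies in [S]. It is
    disjoint from [Y], and its size therefore fits into what [Y] leaves of the budget. *)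
Lemma check_complete K : size S <= K -> check a n U Y Z K.
Proof.
move=> SK.
pose c := flatten [seq [seq w <- class a n U Y g | w \in S] | g <- signatures a n U Y].
have hc : choice (groups a n U Y Z) c.
  rewrite /c /groups; elim/last_ind: (signatures _ _ _ _) => [|gs g IH]; first exact: Choice0.
  by rewrite !map_rcons flatten_rcons; apply: ChoiceS => //; apply: solution_option.
have [uc cr _ _] := choice_groups hc.
have Xc s : s \in X -> s \in c.
  rewrite mem_filter => /andP [sS sr]; apply/flatten_mapP; exists (signature a Y s).
    by rewrite mem_undup map_f.
  by rewrite mem_filter sS mem_class sr eqxx.
have cS s : s \in c -> s \in S.
  by case/flatten_mapP => g _; rewrite mem_filter => /andP [].
have nS : n \notin S by apply/negP => /Sn; rewrite ltnn.
have sz : size (Y ++ c) <= size S.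
  apply: uniq_leq_size.
    rewrite cat_uniq uc filter_uniq // andbT; apply/hasPn => w /cr; rewrite mem_rest => /andP [_].
    by apply: contra; rewrite mem_filter => /andP [].
  by move=> s; rewrite mem_cat => /orP [|/cS //]; rewrite mem_filter => /andP [].
rewrite size_cat in sz; have YcK := leq_trans sz SK; have YK := leq_trans (leq_addr _ _) YcK.
apply/and3P; split=> //.
  apply/allP => u; rewrite mem_filter => /andP [/andP [uY uZ] uU].
  have uS : u \notin S by apply: contra uY => uS; rewrite mem_filter uS.
  have := hS (Un uU) (leqnn n) (negbT (ltn_eqF (Un uU))) uS nS.
  rewrite separates_n // => /hasP [s sS aus]; apply/hasP; exists s => //.
  case/orP: (mem_solution sS) => // sX; move: uZ; rewrite mem_filter uU andbT.
  by move=> /hasPn /(_ s sX); rewrite aus.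
apply/choice_okP; exists c; split=> //; first by rewrite leq_subRL.
move=> x y; rewrite !inE /settled => /orP [->|xU]; first by rewrite !orbT.
have xn := ltn_eqF (Un xU); rewrite xn /=.
case/orP => [/eqP ->|yU].
  rewrite xn eqxx /= separates_n //; case xZ: (x \in Z); last by rewrite !orbT.
  move: xZ; rewrite mem_filter => /andP [/hasP [t tX axt] _].
  by apply/orP; right; apply/hasP; exists t; rewrite ?Xc.
rewrite (ltn_eqF (Un yU)); case: eqP => //= /eqP ne.
case xY: (x \in Y) => //=; case yY: (y \in Y) => //=.
have xS : x \notin S by apply: contraFN xY => xS; rewrite mem_filter xS.
have yS : y \notin S by apply: contraFN yY => yS; rewrite mem_filter yS.
have /hasP [s sS sep] := hS (Un xU) (ltnW (Un yU)) ne xS yS.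
apply/orP; case/orP: (mem_solution sS) => [sY|sX]; [left|right]; apply/hasP; exists s => //.
exact: Xc.
Qed.

End Completeness.

(** * Running time of the check of one guess *)

Definition adj_nat (M : seq (seq bool)) (u v : nat) : bool := nth false (nth [::] M u) v.

Section Bounded.
Context (J : Type) {cJ : code J}.
Implicit Types (D : J -> Prop) (m n : J -> nat).

(** Tests on unary numbers take time depending on their values, so computability is carried together
    with a bound. The bound is not strict because the extra item [n] occurs as a value. *)
Definition pcn D m n (x : J -> nat) := pc D m x /\ forall j, D j -> x j <= n j.

Definition pcl D m n (l : J -> seq nat) := [/\ pc D m l,
  forall j, D j -> size (l j) <= n j & forall j y, D j -> y \in l j -> y <= n j].

(* [n] bounds the vertices and the lengths of the lists of vertices. *)
Definition pcM D m n (M : J -> seq (seq bool)) := [/\ pb D m n, pc D m n & pc D m M].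

Definition pcguess D m n M (U Y Z : J -> seq nat) :=
  [/\ pcM D m n M, pcl D m n U, pcl D m n Y & pcl D m n Z].

End Bounded.

Section Weaken.
Context (J B : Type) {cJ : code J} {cB : code B} (D : J -> Prop) (D' : J * B -> Prop).
Variables (m n : J -> nat).
Hypothesis hD : forall q, D' q -> D q.1.

Lemma pcn_wk x : pcn D m n x -> pcn D' (fun q => m q.1) (fun q => n q.1) (fun q => x q.1).
Proof. by case=> hx bx; split=> [|q /hD]; [apply: pc_wk hx hD | apply: bx]. Qed.

Lemma pcl_wk l : pcl D m n l -> pcl D' (fun q => m q.1) (fun q => n q.1) (fun q => l q.1).
Proof.
case=> hl sl bl; split=> [|q /hD|q y /hD]; [|exact: sl|exact: bl].
exact (pc_wk hl hD).
Qed.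

Lemma pcM_wk M : pcM D m n M -> pcM D' (fun q => m q.1) (fun q => n q.1) (fun q => M q.1).
Proof.
by case=> bn hn hM; split; [apply: pb_wk bn hD | apply: pc_wk hn hD | apply: pc_wk hM hD].
Qed.

Lemma pcguess_wk M U Y Z : pcguess D m n M U Y Z ->
  pcguess D' (fun q => m q.1) (fun q => n q.1) (fun q => M q.1)
    (fun q => U q.1) (fun q => Y q.1) (fun q => Z q.1).
Proof.
by case=> hM hU hY hZ; split; [apply: pcM_wk | apply: pcl_wk | apply: pcl_wk | apply: pcl_wk].
Qed.

End Weaken.

Lemma pcn_mem J {cJ : code J} (D : J -> Prop) (D' : J * nat -> Prop) m n l :
  pcl D m n l -> (forall q, D' q -> D q.1 /\ q.2 \in l q.1) ->
  pcn D' (fun q => m q.1) (fun q => n q.1) (fun q => q.2).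
Proof.
by case=> _ _ bl hD; split=> [|q /hD [Dq /bl]]; [exact: pc_2 | apply].
Qed.

Section Operations.
Context (J : Type) {cJ : code J} (D : J -> Prop) (m n : J -> nat) (M : J -> seq (seq bool)).
Hypothesis hM : pcM D m n M.

Lemma pb_pcn x : pcn D m n x -> pb D m x.
Proof. by case: hM => bn _ _ [_ bx]; apply: pb_le bn bx. Qed.

Lemma pb_pcl l : pcl D m n l -> pb D m (fun j => size (l j)).
Proof. by case: hM => bn _ _ [_ bl _]; apply: pb_le bn bl. Qed.

Lemma pc_eqn' x y : pcn D m n x -> pcn D m n y -> pc D m (fun j => x j == y j).
Proof. by move=> hx hy; apply: pc_eqn; [case: hx | case: hy | apply: pb_pcn | apply: pb_pcn]. Qed.

Lemma pc_adj_nat x y : pcn D m n x -> pcn D m n y ->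
  pc D m (fun j => adj_nat (M j) (x j) (y j)).
Proof.
move=> hx hy; have [_ _ pM] := hM.
apply: pc_nth; [by case: hy | exact: pb_pcn | exact: pc_false |].
by apply: pc_nth; [case: hx | exact: pb_pcn | exact: pc_nil |].
Qed.

End Operations.

Lemma pc_memn J {cJ : code J} (D : J -> Prop) m n M x l :
  pcM D m n M -> pcn D m n x -> pcl D m n l -> pc D m (fun j => x j \in l j).
Proof.
move=> hM hx hl; apply: pc_mem; [by case: hl | exact (pb_pcl hM hl) |].
have hD (q : J * nat) : D q.1 /\ q.2 \in l q.1 -> D q.1 by case.
exact (pc_eqn' (pcM_wk hD hM) (pcn_wk hD hx) (pcn_mem hl (fun _ h => h))).
Qed.

Lemma pcl_filter J {cJ : code J} (D : J -> Prop) m n M l (f : J -> nat -> bool) :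
  pcM D m n M -> pcl D m n l ->
  pc (fun q : J * nat => D q.1 /\ q.2 \in l q.1) (fun q => m q.1) (fun q => f q.1 q.2) ->
  pcl D m n (fun j => [seq y <- l j | f j y]).
Proof.
move=> hM hl hf; have [pl sl bl] := hl; split.
- exact: pc_filter pl (pb_pcl hM hl) hf.
- by move=> j Dj; apply: leq_trans (sl j Dj); rewrite size_filter count_size.
- by move=> j y Dj; rewrite mem_filter => /andP [_]; apply: bl.
Qed.

Lemma pcl_rest J {cJ : code J} (D : J -> Prop) m n M U :
  pcM D m n M -> pcl D m n U -> pcl D m n (fun j => rest (n j) (U j)).
Proof.
move=> hM hU; have [bn hn _] := hM; have hi : pcl D m n (fun j => iota 0 (n j)).
  split=> [|j _|j y _]; [exact: pc_iota | by rewrite size_iota |].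
  by rewrite mem_iota => /andP [_ /ltnW].
apply: (pcl_filter (f := fun j w => w \notin U j) hM hi); apply: pc_negb.
have hD (q : J * nat) : D q.1 /\ q.2 \in iota 0 (n q.1) -> D q.1 by case.
exact (pc_memn (pcM_wk hD hM) (pcn_mem hi (fun _ h => h)) (pcl_wk hD hU)).
Qed.

Lemma pc_signature J {cJ : code J} (D : J -> Prop) m n M Y x :
  pcM D m n M -> pcl D m n Y -> pcn D m n x ->
  pc D m (fun j => signature (adj_nat (M j)) (Y j) (x j)).
Proof.
move=> hM hY hx; have hD (q : J * nat) : D q.1 /\ q.2 \in Y q.1 -> D q.1 by case.
apply: (pc_map (f := fun j y => adj_nat (M j) (x j) y)); [by case: hY | exact (pb_pcl hM hY) |].
exact (pc_adj_nat (pcM_wk hD hM) (pcn_wk hD hx) (pcn_mem hY (fun _ h => h))).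
Qed.

Lemma pb_signature J {cJ : code J} (D : J -> Prop) m n M Y x :
  pcM D m n M -> pcl D m n Y -> pb D m (fun j => size (signature (adj_nat (M j)) (Y j) (x j))).
Proof. by move=> hM hY; apply: pb_le (pb_pcl hM hY) _ => j _; rewrite size_map. Qed.

Lemma pc_has_adj J {cJ : code J} (D : J -> Prop) m n M Y x :
  pcM D m n M -> pcl D m n Y -> pcn D m n x ->
  pc D m (fun j => has (adj_nat (M j) (x j)) (Y j)).
Proof.
move=> hM hY hx; have hD (q : J * nat) : D q.1 /\ q.2 \in Y q.1 -> D q.1 by case.
apply: (pc_has (f := fun j y => adj_nat (M j) (x j) y)); [by case: hY | exact (pb_pcl hM hY) |].
exact (pc_adj_nat (pcM_wk hD hM) (pcn_wk hD hx) (pcn_mem hY (fun _ h => h))).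
Qed.

Lemma pc_separates J {cJ : code J} (D : J -> Prop) m n M Y x y :
  pcM D m n M -> pcl D m n Y -> pcn D m n x -> pcn D m n y ->
  pc D m (fun j => separates (touches (adj_nat (M j))) (Y j) (x j) (y j)).
Proof.
move=> hM hY hx hy; have hD (q : J * nat) : D q.1 /\ q.2 \in Y q.1 -> D q.1 by case.
apply: (pc_has (f := fun j t => adj_nat (M j) (x j) t (+) adj_nat (M j) (y j) t));
  [by case: hY | exact (pb_pcl hM hY) |].
apply: pc_addb.
  exact (pc_adj_nat (pcM_wk hD hM) (pcn_wk hD hx) (pcn_mem hY (fun _ h => h))).
exact (pc_adj_nat (pcM_wk hD hM) (pcn_wk hD hy) (pcn_mem hY (fun _ h => h))).
Qed.

Lemma pcl_free J {cJ : code J} (D : J -> Prop) m n M U Y Z :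
  pcguess D m n M U Y Z -> pcl D m n (fun j => free (U j) (Y j) (Z j)).
Proof.
case=> hM hU hY hZ; have hD (q : J * nat) : D q.1 /\ q.2 \in U q.1 -> D q.1 by case.
apply: (pcl_filter (f := fun j u => (u \notin Y j) && (u \notin Z j)) hM hU).
apply: pc_andb; apply: pc_negb.
  exact (pc_memn (pcM_wk hD hM) (pcn_mem hU (fun _ h => h)) (pcl_wk hD hY)).
have hD' (q : J * nat) : (D q.1 /\ q.2 \in U q.1) /\ q.2 \notin Y q.1 -> D q.1 by case=> -[].
exact (pc_memn (pcM_wk hD' hM) (pcn_mem hU (fun _ h => proj1 h)) (pcl_wk hD' hZ)).
Qed.

Lemma pc_allowed J {cJ : code J} (D : J -> Prop) m n M U Y Z z :
  pcguess D m n M U Y Z -> pcn D m n z ->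
  pc D m (fun j => allowed (adj_nat (M j)) (U j) (Y j) (Z j) (z j)).
Proof.
move=> hg hz; have [hM hU hY hZ] := hg; have hF := pcl_free hg.
apply: pc_andb; first exact (pc_has_adj hM hY hz).
apply: pc_negb.
apply: (pc_has (f := fun j u => signature (adj_nat (M j)) (Y j) u == signature (adj_nat (M j)) (Y j) (z j))).
- by case: hF => hF _ _; apply: pc_mono hF _ => j [].
- by apply: pb_mono (pb_pcl hM hF) _ => j [].
set D' := fun q : J * nat => _; have hD q : D' q -> D q.1 by case=> -[].
pose proof (pcM_wk hD hM) as hM'; pose proof (pcl_wk hD hY) as hY'.
have hF' : pcn D' (fun q => m q.1) (fun q => n q.1) (fun q => q.2).
  by apply: (pcn_mem hF) => q [[]].
apply: pc_eqbits.
- exact (pc_signature hM' hY' hF').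
- exact (pc_signature hM' hY' (pcn_wk hD hz)).
- exact (pb_signature _ hM' hY').
- exact (pb_signature _ hM' hY').
Qed.

Lemma pcl_class J {cJ : code J} (D : J -> Prop) m n M U Y g :
  pcM D m n M -> pcl D m n U -> pcl D m n Y -> pc D m g -> pb D m (fun j => size (g j)) ->
  pcl D m n (fun j => class (adj_nat (M j)) (n j) (U j) (Y j) (g j)).
Proof.
move=> hM hU hY hg bg; have hR := pcl_rest hM hU.
apply: (pcl_filter (f := fun j w => signature (adj_nat (M j)) (Y j) w == g j) hM hR).
set D' := fun q : J * nat => _; have hD q : D' q -> D q.1 by case.
pose proof (pcM_wk hD hM) as hM'; pose proof (pcl_wk hD hY) as hY'.
apply: pc_eqbits.
- exact (pc_signature hM' hY' (pcn_mem hR (fun _ h => h))).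
- exact (pc_wk hg hD).
- exact (pb_signature _ hM' hY').
- exact (pb_wk bg hD).
Qed.

Lemma pc_options J {cJ : code J} (D : J -> Prop) m n M U Y Z g :
  pcguess D m n M U Y Z -> pc D m g -> pb D m (fun j => size (g j)) ->
  pc D m (fun j => options (adj_nat (M j)) (n j) (U j) (Y j) (Z j) (g j)).
Proof.
move=> hG hg bg; have [hM hU hY hZ] := hG; have hC := pcl_class hM hU hY hg bg.
apply: pc_cons; first by case: hC.
have hA : pcl D m n (fun j => [seq z <- class (adj_nat (M j)) (n j) (U j) (Y j) (g j)
       | allowed (adj_nat (M j)) (U j) (Y j) (Z j) z]).
  apply: (pcl_filter (f := fun j => allowed (adj_nat (M j)) (U j) (Y j) (Z j)) hM hC).
  set D' := fun q : J * nat => _; have hD q : D' q -> D q.1 by case.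
  exact (pc_allowed (pcguess_wk hD hG) (pcn_mem hC (fun _ h => h))).
apply: (pc_map (f := fun j z => [seq w <- class (adj_nat (M j)) (n j) (U j) (Y j) (g j) | w != z])).
- by case: hA.
- exact (pb_pcl hM hA).
set D' := fun q : J * nat => _; have hD q : D' q -> D q.1 by case.
pose proof (pcM_wk hD hM) as hM'; pose proof (pcl_wk hD hC) as hC'.
enough (H : pcl D' (fun q => m q.1) (fun q => n q.1) (fun q =>
  [seq w <- class (adj_nat (M q.1)) (n q.1) (U q.1) (Y q.1) (g q.1) | w != q.2])).
  by case: H => h _ _; apply: h.
apply: (@pcl_filter _ _ _ _ _ _ _ (fun (q : J * nat) w => w != q.2) hM' hC'); apply: pc_negb.
set E := fun q : J * nat * nat => _; have hE q : E q -> D' q.1 by case.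
exact (pc_eqn' (pcM_wk hE hM') (pcn_mem hC' (fun _ h => h)) (pcn_wk hE (pcn_mem hA (fun _ h => h)))).
Qed.

Lemma pc_signatures J {cJ : code J} (D : J -> Prop) m n M U Y :
  pcM D m n M -> pcl D m n U -> pcl D m n Y ->
  pc D m (fun j => signatures (adj_nat (M j)) (n j) (U j) (Y j)).
Proof.
move=> hM hU hY; have hR := pcl_rest hM hU; have [pR _ _] := hR; have bR := pb_pcl hM hR.
set L := fun j => [seq signature (adj_nat (M j)) (Y j) w | w <- rest (n j) (U j)].
apply: (pc_undup (l := L)).
- apply: (pc_map (f := fun j => signature (adj_nat (M j)) (Y j)) pR bR).
  set D' := fun q : J * nat => _; have hD q : D' q -> D q.1 by case.
  exact (pc_signature (pcM_wk hD hM) (pcl_wk hD hY) (pcn_mem hR (fun _ h => h))).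
- by apply: pb_le bR _ => j _; rewrite size_map.
case: (pb_pcl hM hY) => c hc.
apply: pc_eqbits; [by apply: pc_snd; exact: pc_1 | exact: pc_2 | |]; exists c => q [Dq];
  move=> /mapP [v _ e1] /mapP [w _ e2]; rewrite ?e1 ?e2 size_map; exact: hc.
Qed.

Lemma pc_groups J {cJ : code J} (D : J -> Prop) m n M U Y Z :
  pcguess D m n M U Y Z ->
  pc D m (fun j => groups (adj_nat (M j)) (n j) (U j) (Y j) (Z j)) /\
  pb D m (fun j => size (groups (adj_nat (M j)) (n j) (U j) (Y j) (Z j))).
Proof.
move=> hG; have [hM hU hY hZ] := hG; have hS := pc_signatures hM hU hY.
have bS : pb D m (fun j => size (signatures (adj_nat (M j)) (n j) (U j) (Y j))).
  apply: pb_le (pb_pcl hM (pcl_rest hM hU)) _ => j _.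
  by apply: leq_trans (size_undup _) _; rewrite size_map.
split; last by apply: pb_le bS _ => j _; rewrite size_map.
apply: (pc_map (f := fun j => options (adj_nat (M j)) (n j) (U j) (Y j) (Z j)) hS bS).
set D' := fun q : J * _ => _; have hD q : D' q -> D q.1 by case.
apply: (pc_options (pcguess_wk hD hG) (pc_2 _ _)).
apply: (@pb_le _ _ _ _ (fun q => size (Y q.1))).
  exact (pb_wk (pb_pcl hM hY) hD).
by move=> [j g] [_]; rewrite mem_undup => /mapP [w _ /= ->]; rewrite size_map.
Qed.

Lemma pc_settled J {cJ : code J} (D : J -> Prop) m n M U Y Z x y :
  pcguess D m n M U Y Z -> pcn D m n x -> pcn D m n y ->
  pc D m (fun j => settled (adj_nat (M j)) (n j) (Y j) (Z j) (x j) (y j)).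
Proof.
move=> [hM hU hY hZ] hx hy; have [bn pn _] := hM.
have hn : pcn D m n n by split.
apply: pc_orb; first exact (pc_eqn' hM hx hy).
apply: pc_orb; first exact (pc_memn hM hx hY).
apply: pc_orb; first exact (pc_memn hM hy hY).
apply: pc_orb; first exact (pc_eqn' hM hx hn).
apply: pc_if; first exact (pc_eqn' hM hy hn).
  by apply: pc_mono (pc_negb (pc_memn hM hx hZ)) _ => j [].
by apply: pc_mono (pc_separates hM hY hx hy) _ => j [].
Qed.

Lemma mem_groups a n U Y Z o : o \in flatten (groups a n U Y Z) ->
  {subset o <= rest n U} /\ size o <= n.
Proof.
case/flattenP => _ /mapP [g _ ->] /mem_options [uo so _ _].
have oR : {subset o <= rest n U} by move=> w /so; rewrite mem_class => /andP [].
split=> //; rewrite -[X in _ <= X](size_iota 0); apply: uniq_leq_size uo _ => w /oR.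
by rewrite mem_rest mem_iota add0n => /andP [].
Qed.

Lemma pc_check J {cJ : code J} (D : J -> Prop) m n M U Y Z K :
  pcguess D m n M U Y Z -> pcn D m n K ->
  pb D m (fun j => (size (U j)).+1 ^ (size (U j)).+1) ->
  pc D m (fun j => check (adj_nat (M j)) (n j) (U j) (Y j) (Z j) (K j)).
Proof.
move=> hg hK bXX; have [hM hU hY hZ] := hg; have [bn pn _] := hM.
have [hG bG] := pc_groups hg; have hF := pcl_free hg.
have hs : pc D m (fun j => size (Y j)) by apply: pc_size; [case: hY | exact (pb_pcl hM hY)].
apply: pc_andb.
  apply: (pc_all (f := fun j u => has (adj_nat (M j) u) (Y j))); [by case: hF | exact (pb_pcl hM hF) |].
  set D' := fun q : J * nat => _; have hD q : D' q -> D q.1 by case.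
  exact (pc_has_adj (pcM_wk hD hM) (pcl_wk hD hY) (pcn_mem hF (fun _ h => h))).
apply: pc_mono (_ : pc D m _) _; last by move=> j [].
apply: pc_andb; first by apply: pc_leq => //; [case: hK | exact (pb_pcn hM hK)].
apply: pc_mono (_ : pc D m _) _; last by move=> j [].
apply: (pc_choice_ok (f := fun j => touches (adj_nat (M j)))
  (ini := fun j => settled (adj_nat (M j)) (n j) (Y j) (Z j)) (X := fun j => n j :: U j)) => //.
- by apply: pc_cons => //; case: hU.
- by apply: pb_le (pb_add (pb_pcl hM hU) (pb_const _ _ 1)) _ => j _; rewrite addn1.
- apply: (@pb_le _ _ _ _ (fun q => n q.1 + 1)).
    by apply: (@pb_wk _ _ D _ _ (fun j => n j + 1)); [apply: pb_add => //; apply: pb_const | move=> q []].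
  move=> [j g] /= [_ /InP /mapP [g0 _ ->]]; rewrite /options /= size_map addn1 ltnS.
  rewrite -[X in _ <= X](size_iota 0); apply: uniq_leq_size; first by rewrite !filter_uniq ?iota_uniq.
  move=> w; rewrite mem_filter mem_class mem_rest mem_iota add0n.
  by move=> /andP [_ /andP [/andP [-> _] _]].
- apply: (@pb_le _ _ _ _ (fun q => n q.1)); first by apply: pb_wk bn _ => q [].
  by move=> [j o] /= [_ /InP /mem_groups []].
- by apply: pc_sub => //; [case: hK | exact (pb_pcl hM hY)].
- by apply: pb_le (pb_pcn hM hK) _ => j _; apply: leq_subr.
- set D' := fun q : J * nat * nat => _.
  have hD q : D' q -> D q.1.1 by case.
  have hM' : pcM D' (fun q => m q.1.1) (fun q => n q.1.1) (fun q => M q.1.1).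
    apply: (@pcM_wk _ _ _ _ (fun q => D q.1) D' (fun q => m q.1) (fun q => n q.1) hD (fun q => M q.1)).
    by apply: pcM_wk hM.
  apply: (pc_adj_nat hM').
    split; first exact: pc_2.
    move=> [[j t] x] [Dj _ /=]; rewrite inE => /orP [/eqP -> //|xU].
    by case: hU => _ _ /(_ j x Dj xU).
  split; first by apply: pc_snd; exact: pc_1.
  move=> [[j t] x] /= [Dj [o /mem_groups [oR _] /oR]].
  by rewrite mem_rest => /andP [/ltnW].
set D' := fun q : J * (nat * nat) => _; have hD q : D' q -> D q.1 by case.
have bX j x : D j -> x \in n j :: U j -> x <= n j.
  by move=> Dj; rewrite inE => /orP [/eqP -> //|xU]; case: hU => _ _ /(_ j x Dj xU).
pose proof (pcguess_wk hD hg) as hg'.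
apply: (pc_settled hg').
  by split; [apply: pc_fst; exact: pc_2 | move=> [j [x y]] [Dj xX _]; apply: bX].
by split; [apply: pc_snd; exact: pc_2 | move=> [j [x y]] [Dj _ yX]; apply: bX].
Qed.

(** * Graphs and their adjacency matrices *)

Section Bridge.
Variable G : sgraph.
Notation n := (nverts G).

Definition adj_matrix : seq (seq bool) :=
  [seq [seq adj u v | v <- enum 'I_n] | u <- enum 'I_n].

Lemma adj_natE (u v : 'I_n) : adj_nat adj_matrix u v = adj u v.
Proof.
by rewrite /adj_nat (nth_map u) ?size_enum_ord // (nth_map u) ?size_enum_ord // !nth_ord_enum.
Qed.

Lemma adj_nat_lt u v : adj_nat adj_matrix u v -> (u < n) && (v < n).
Proof.
rewrite /adj_nat; case: (ltnP u n) => [lu|gu]; last first.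
  by rewrite [nth [::] _ u]nth_default ?nth_nil ?size_map -?enumT ?size_enum_ord.
rewrite (nth_map (Ordinal lu)) ?size_enum_ord //; case: ltnP => // gv.
by rewrite nth_default // size_map size_enum_ord.
Qed.

Lemma adj_nat_ltl u v : adj_nat adj_matrix u v -> u < n.
Proof. by case/adj_nat_lt/andP. Qed.

Lemma adj_nat_irr u : adj_nat adj_matrix u u = false.
Proof.
apply/negP => a; have /andP [lu _] := adj_nat_lt a.
by move: a; rewrite (adj_natE (Ordinal lu) (Ordinal lu)) adj_irr.
Qed.

(** Separation of two vertices is the difference of their traces on [S]; separation of a vertex from
    the item [n], which has no neighbours, is domination. *)
Lemma locating_dominatingP (S : {set 'I_n}) (s : seq nat) :
  (forall u : 'I_n, (val u \in s) = (u \in S)) -> (forall u, u \in s -> u < n) ->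
  locating_dominating S <-> ld (adj_nat adj_matrix) n s.
Proof.
move=> sS sn.
have sepP (u v : 'I_n) : separates (touches (adj_nat adj_matrix)) s u v =
    (nbh u :&: S != nbh v :&: S).
  apply/hasP/idP => [[t ts] /= | ne].
    pose t' := Ordinal (sn t ts).
    rewrite /touches (adj_natE u t') (adj_natE v t') => h; apply/eqP => /setP /(_ t').
    by rewrite !inE -sS /= ts !andbT => e; rewrite e addbb in h.
  case: (boolP [forall t, (t \in nbh u :&: S) == (t \in nbh v :&: S)]) => [/forallP h|].
    by case/eqP: ne; apply/setP => t; apply/eqP.
  case/forallPn => t; rewrite !inE -!sS; case ts: (val t \in s); last by rewrite !andbF.
  rewrite !andbT => h; exists (val t) => //; rewrite /touches !adj_natE.
  by move: h; case: (adj u t); case: (adj v t).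
have nS : n \notin s by apply/negP => /sn; rewrite ltnn.
split=> [/andP [/forallP dom /forallP loc] u v lu lv ne us vs | h].
  move: lv; rewrite leq_eqVlt => /orP [/eqP ->|lv].
    have := dom (Ordinal lu); rewrite -sS /= (negbTE us) /= => /existsP [t /andP [tS a]].
    rewrite separates_n; last exact: adj_nat_ltl.
    by apply/hasP; exists (val t); rewrite ?sS // (adj_natE (Ordinal lu)).
  rewrite (sepP (Ordinal lu) (Ordinal lv)).
  have /forallP /(_ (Ordinal lv)) /implyP := loc (Ordinal lu).
  by apply; rewrite -!sS /= us vs -val_eqE.
apply/andP; split.
  apply/forallP => u; case uS: (u \in S) => //=.
  have := h u n (ltn_ord u) (leqnn n) (negbT (ltn_eqF (ltn_ord u))).
  rewrite sS uS => /(_ isT nS); rewrite separates_n; last exact: adj_nat_ltl.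
  case/hasP => t ts; rewrite (adj_natE u (Ordinal (sn t ts))) => a.
  by apply/existsP; exists (Ordinal (sn t ts)); rewrite -sS a andbT.
apply/forallP => u; apply/forallP => v; apply/implyP => /and3P [uS vS ne].
by rewrite -sepP; apply: h; rewrite ?sS ?val_eqE //; apply: ltnW; apply: ltn_ord.
Qed.

Definition cover : seq nat := greedy_cover (adj_nat adj_matrix) n.

Lemma mem_pairs_iota p : p \in item_pairs (iota 0 n) -> (p.1 < n) && (p.2 < n).
Proof. by rewrite mem_item_pairs !mem_iota. Qed.

Lemma cover_uniq : uniq cover.
Proof. by have [] := cover_stepsP adj_nat_irr (item_pairs (iota 0 n)). Qed.

Lemma cover_lt u : u \in cover -> u < n.
Proof.
have [_ _ h _ _] := cover_stepsP adj_nat_irr (item_pairs (iota 0 n)).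
by move=> /h [p /mem_pairs_iota /andP [p1 p2] /orP [] /eqP ->].
Qed.

Lemma cover_covers u v : adj_nat adj_matrix u v -> (u \in cover) || (v \in cover).
Proof.
have [_ _ _ h _] := cover_stepsP adj_nat_irr (item_pairs (iota 0 n)).
move=> a; apply: (h (u, v)) => //; rewrite mem_item_pairs !mem_iota /=.
exact: adj_nat_lt.
Qed.

Lemma size_cover : size cover <= 2 * vc G.
Proof.
rewrite /vc; case: arg_minnP => [|C hC _].
  by apply/forallP => u; apply/forallP => v; rewrite !inE implybT.
have [_ _ _ _ h] := cover_stepsP adj_nat_irr (item_pairs (iota 0 n)).
have {h} h := h (fun u => u \in [seq val v | v <- enum C]).
apply: leq_trans (h _) _.
  move=> u v a; have /andP [lu lv] := adj_nat_lt a.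
  move: a; rewrite (adj_natE (Ordinal lu) (Ordinal lv)) => a.
  have /forallP /(_ (Ordinal lu)) /forallP /(_ (Ordinal lv)) := hC.
  rewrite a => /orP [] i; apply/orP; [left|right]; apply/mapP; [exists (Ordinal lu)|exists (Ordinal lv)];
    by rewrite ?mem_enum.
rewrite leq_mul2l /= cardE -(size_map val) -size_filter; apply: uniq_leq_size.
  by rewrite filter_uniq // cover_uniq.
by move=> u; rewrite mem_filter => /andP [].
Qed.

(** [Y] and [Z] range independently over all sublists of the cover. The guesses made in the
    completeness proof are filters of the cover, hence among them. *)
Definition cover_check (K : nat) : bool :=
  has (fun Y => has (fun Z => check (adj_nat adj_matrix) n cover Y Z K) (sublists cover))
    (sublists cover).

Lemma cover_checkP K :
  reflect (exists2 S : {set 'I_n}, locating_dominating S & #|S| <= K) (cover_check K).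
Proof.
apply: (iffP hasP) => [[Y /sublists_subseq sY /hasP [Z _ hc]] | [S hS SK]].
  have [s [us sn hs sK]] := check_sound (@adj_nat_ltl) (@cover_lt) (@cover_covers)
    (subseq_uniq sY cover_uniq) (mem_subseq sY) hc.
  exists [set u : 'I_n | val u \in s].
    by apply/(locating_dominatingP (s := s)) => // u; rewrite inE.
  apply: leq_trans sK; rewrite cardE -(size_map val); apply: uniq_leq_size.
    by rewrite map_inj_uniq ?enum_uniq //; apply: val_inj.
  by move=> u /mapP [v]; rewrite mem_enum inE => h ->.
pose s := [seq val u | u <- enum S].
have sS (u : 'I_n) : (val u \in s) = (u \in S) by rewrite mem_map ?mem_enum //; apply: val_inj.
have sn u : u \in s -> u < n by case/mapP => v _ ->; apply: ltn_ord.
have ls : ld (adj_nat adj_matrix) n s by apply/(locating_dominatingP sS sn).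
have ss : size s <= K by rewrite size_map -cardE.
have hc := check_complete (@adj_nat_ltl) cover_uniq (@cover_lt) (@cover_covers) sn ls ss.
eexists; last by apply/hasP; eexists; last exact: hc; exact: filter_sublists.
exact: filter_sublists.
Qed.

End Bridge.

(** The base [k.+1] counts the cover and the extra item. For v >= 2 and t the rounded-down
    logarithm, 2v + 1 <= v^3 < 2^(3(t+1)), and 3(t+1)(2v+1) <= 3 * 2t * 3v = 18vt. For v = 1 the
    logarithm vanishes, and the factor 27 = 3^3 covers that case. *)
Lemma bound_nlogn v k : k <= 2 * v -> k.+1 ^ k.+1 <= 27 * (2 ^ nlogn v) ^ 18.
Proof.
move=> kv; apply: (@leq_trans ((2 * v).+1 ^ (2 * v).+1)).
  apply: (@leq_trans ((2 * v).+1 ^ k.+1)); first by rewrite leq_exp2r.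
  by rewrite leq_pexp2l.
case: v kv => [|[|v]] _ //; set w := v.+2.
apply: (@leq_trans ((2 ^ nlogn w) ^ 18)); last by rewrite leq_pmull.
have t0 : 0 < trunc_log 2 w by rewrite trunc_log_gt0.
have w3 : (2 * w).+1 <= (2 ^ (trunc_log 2 w).+1) ^ 3.
  apply: (@leq_trans (w ^ 3)).
    by rewrite /w; nia.
  by rewrite leq_exp2r // ltnW // trunc_log_ltn.
apply: (@leq_trans (((2 ^ (trunc_log 2 w).+1) ^ 3) ^ (2 * w).+1)); first by rewrite leq_exp2r.
rewrite -!expnM leq_exp2l // /nlogn; nia.
Qed.

(** * The complete algorithm for Locating-Dominating Set *)

#[local] Instance code_lds' : code lds_instance := code_lds.

Definition lds_cap (x : lds_instance) := cap (nverts (lds_graph x)) (bits_of `|lds_budget x|%N).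

Definition lds_solve (x : lds_instance) : bool :=
  ~~ (lds_budget x < 0)%R && cover_check (lds_graph x) (lds_cap x).

Lemma ldsE x : lds x = lds_solve x.
Proof.
have Sn (S : {set 'I_(nverts (lds_graph x))}) : #|S| <= nverts (lds_graph x).
  by rewrite -[X in _ <= X]card_ord max_card.
apply/existsP/andP => [[S /andP [hS]]|[z0 /cover_checkP [S hS SK]]].
  by rewrite (budgetE _ (Sn S)) => /andP [-> SK]; split=> //; apply/cover_checkP; exists S.
by exists S; rewrite hS (budgetE _ (Sn S)) z0.
Qed.

(** Every partial cover consists of distinct vertices, so it has at most [n] elements throughout the
    loop. *)
Lemma pcl_cover J {cJ : code J} (D : J -> Prop) m (n : J -> nat) M :
  pcM D m n M -> (forall j, D j -> forall u, adj_nat (M j) u u = false) ->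
  pcl D m n (fun j => greedy_cover (adj_nat (M j)) (n j)).
Proof.
move=> hM airr; have [bn pn _] := hM.
have hmem j l1 l2 u : D j -> item_pairs (iota 0 (n j)) = l1 ++ l2 ->
    u \in foldl (cover_step (adj_nat (M j))) [::] l1 -> u < n j.
  move=> Dj e; have [_ _ h _ _] := cover_stepsP (airr j Dj) l1.
  case/h => p pl; have : p \in item_pairs (iota 0 (n j)) by rewrite e mem_cat pl.
  by rewrite mem_item_pairs !mem_iota !add0n => /andP [/andP [_ p1] /andP [_ p2]] /orP [] /eqP ->.
have hsize j l1 l2 : D j -> item_pairs (iota 0 (n j)) = l1 ++ l2 ->
    size (foldl (cover_step (adj_nat (M j))) [::] l1) <= n j.
  move=> Dj e; rewrite -[X in _ <= X](size_iota 0); apply: uniq_leq_size.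
    by have [] := cover_stepsP (airr j Dj) l1.
  by move=> u /(hmem _ _ _ _ Dj e); rewrite mem_iota add0n.
have bi : pb D m (fun j => size (iota 0 (n j))) by apply: pb_le bn _ => j _; rewrite size_iota.
have pi : pc D m (fun j => iota 0 (n j)) by apply: pc_iota.
split; last 2 first.
- by move=> j Dj; apply: (hsize j _ [::]) => //; rewrite cats0.
- by move=> j y Dj /(hmem _ _ [::] _ Dj); rewrite cats0 => /(_ erefl) /ltnW.
apply: (pc_foldl (f := fun j => cover_step (adj_nat (M j))) (pc_nil _ _) (pc_item_pairs pi bi)).
  exact: pb_item_pairs bi.
set D' := fun q : J * seq nat * (nat * nat) => _.
have hD q : D' q -> D q.1.1 by case.
have hM' : pcM D' (fun q => m q.1.1) (fun q => n q.1.1) (fun q => M q.1.1).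
  apply: (@pcM_wk _ _ _ _ (fun q => D q.1) D' (fun q => m q.1) (fun q => n q.1) hD (fun q => M q.1)).
  by apply: pcM_wk hM.
have hU : pcl D' (fun q => m q.1.1) (fun q => n q.1.1) (fun q => q.1.2).
  split; first by apply: pc_snd; exact: pc_1.
    by move=> [[j s] p] [Dj [l1 [l2 [e /= ->]]]]; apply: hsize Dj e.
  by move=> [[j s] p] y [Dj [l1 [l2 [e /= ->]]]] /(hmem _ _ _ _ Dj e) /ltnW.
have hp q : D' q -> (q.2.1 < n q.1.1) && (q.2.2 < n q.1.1).
  case: q => [[j s] p] [Dj [l1 [l2 [/= e _]]]].
  have : p \in item_pairs (iota 0 (n j)) by rewrite e mem_cat inE eqxx orbT.
  by rewrite mem_item_pairs !mem_iota !add0n.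
have h1 : pcn D' (fun q => m q.1.1) (fun q => n q.1.1) (fun q => q.2.1).
  by split; [apply: pc_fst; exact: pc_2 | move=> q /hp /andP [/ltnW]].
have h2 : pcn D' (fun q => m q.1.1) (fun q => n q.1.1) (fun q => q.2.2).
  by split; [apply: pc_snd; exact: pc_2 | move=> q /hp /andP [_ /ltnW]].
have hs D'' m' : pc D'' m' (fun q : J * seq nat * (nat * nat) => q.1.2) by apply: pc_snd; exact: pc_1.
apply: pc_if => //.
  apply: pc_andb; first exact (pc_adj_nat hM' h1 h2).
  apply: pc_mono (_ : pc D' _ _) _; last by move=> q [].
  apply: pc_andb; first exact (pc_negb (pc_memn hM' h1 hU)).
  by apply: pc_mono (pc_negb (pc_memn hM' h2 hU)) _ => q [].
apply: pc_cons; first by apply: pc_fst; exact: pc_2.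
by apply: pc_cons; first by apply: pc_snd; exact: pc_2.
Qed.

Lemma pc_guesses J {cJ : code J} (D : J -> Prop) m (n : J -> nat) M U K :
  pcM D m n M -> pcl D m n U -> pcn D m n K ->
  pb D m (fun j => 2 ^ size (U j)) -> pb D m (fun j => (size (U j)).+1 ^ (size (U j)).+1) ->
  pc D m (fun j => has (fun Y => has (fun Z => check (adj_nat (M j)) (n j) (U j) Y Z (K j))
    (sublists (U j))) (sublists (U j))).
Proof.
move=> hM hU hK b2 bU; have [pU sU eU] := hU.
have hs : pc D m (fun j => sublists (U j)).
  by apply: pc_sublists => //; exact (pb_pcl hM hU).
have bs : pb D m (fun j => size (sublists (U j))) by apply: pb_le b2 _ => j _; rewrite size_sublists.
apply: (pc_has (f := fun j Y => has (fun Z => check (adj_nat (M j)) (n j) (U j) Y Z (K j)) (sublists (U j)))) => //.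
set D1 := fun q : J * _ => _; have hD1 q : D1 q -> D q.1 by case.
apply: (pc_has (f := fun (q : J * seq nat) Z => check (adj_nat (M q.1)) (n q.1) (U q.1) q.2 Z (K q.1))).
- exact (pc_wk hs hD1).
- exact (pb_wk bs hD1).
set D2 := fun q : J * _ * _ => _; have hD2 q : D2 q -> D1 q.1 by case.
have small s j : D j -> s \in sublists (U j) -> size s <= n j /\ forall y, y \in s -> y <= n j.
  move=> Dj /sublists_subseq su; split; first exact: leq_trans (size_subseq su) (sU j Dj).
  by move=> y /(mem_subseq su); apply: eU.
have hY : pcl D1 (fun q => m q.1) (fun q => n q.1) (fun q => q.2).
  split; first exact: pc_2.
    by move=> [j s] [Dj sj]; case: (small s j Dj sj).
  by move=> [j s] y [Dj sj]; case: (small s j Dj sj) => _; apply.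
have hZ : pcl D2 (fun q => m q.1.1) (fun q => n q.1.1) (fun q => q.2).
  split; first exact: pc_2.
    by move=> [[j t] s] [[Dj _] sj]; case: (small s j Dj sj).
  by move=> [[j t] s] y [[Dj _] sj]; case: (small s j Dj sj) => _; apply.
apply: (pc_check (M := fun q => M q.1.1) (U := fun q => U q.1.1) (Y := fun q => q.1.2)
  (Z := fun q => q.2) (K := fun q => K q.1.1) (n := fun q => n q.1.1)).
- split=> //.
  + exact (pcM_wk hD2 (pcM_wk hD1 hM)).
  + exact (pcl_wk hD2 (pcl_wk hD1 hU)).
  + exact (pcl_wk hD2 hY).
- exact (pcn_wk hD2 (pcn_wk hD1 hK)).
- exact (pb_wk (pb_wk bU hD1) hD2).
Qed.

(** The vertex cover number is never computed. It enters only through the measure, and [size_cover]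
    compares it with the greedy cover that the program constructs. *)
Lemma locating_dominating_solvable :
  solvable_in_time code_lds lds (fun x => nlogn (vc (lds_graph x)))
    (fun x => nverts (lds_graph x)).
Proof.
apply: pc_solvable; set D := (X in pc X); set m := (X in pc _ X).
pose n x := nverts (lds_graph x).
pose M x := adj_matrix (lds_graph x).
have bn : pb D m n.
  apply: pb_le (pb_m _ _) _ => x _; rewrite /m /n; apply: leq_trans (leqnSn _) _.
  by rewrite leq_pmull // expn_gt0.
have pM : pc D m M.
  apply: (@pc_projl _ _ _ tree _ _ _ id _ _ id _ (fun x => code_int (lds_budget x))) (pc_id _ _) => x _ /=.
  rewrite {1}/enc /code_lds' /code_lds; congr (Node _ _).
  by rewrite enc_map; congr code_seq; apply: eq_map => u; rewrite enc_map.
have pB : pc D m (fun x => ((lds_budget x < 0)%R, bits_of `|lds_budget x|%N)).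
  apply: (@pc_projr _ _ tree _ _ _ id _ _ _ id (fun x => code_graph (lds_graph x))) (pc_id _ _) => x _ /=.
  rewrite {1}/enc /code_lds' /code_lds; congr (Node _ _).
  by rewrite /code_int -enc_bits_of.
have sM x : size (M x) = n x by rewrite size_map size_enum_ord.
have pn : pc D m n.
  by apply: pc_ext (pc_size pM _) _ => [|x _]; [apply: pb_le bn _ => x _; rewrite sM | exact: sM].
have hM : pcM D m n M by split.
have hU : pcl D m n (fun x => cover (lds_graph x)).
  by apply: pcl_cover hM _ => x _ u; apply: adj_nat_irr.
have hK : pcn D m n lds_cap.
  split; last by move=> x _; rewrite /lds_cap capE geq_minl.
  by apply: pc_cap => //; apply: pc_snd pB.
apply: (@pc_ext _ _ _ _ _ _ lds_solve); last by move=> x _; rewrite ldsE.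
apply: pc_andb; first exact: pc_negb (pc_fst pB).
apply: pc_mono (_ : pc D m _) _ => //.
have bU : pb D m (fun x => (size (cover (lds_graph x))).+1 ^ (size (cover (lds_graph x))).+1).
  apply: (@pb_le _ _ _ _ (fun x => 27 * m x ^ 18)).
    by apply: pb_mul (pb_const _ _ _) _; apply: pb_exp; apply: pb_m.
  move=> x _; apply: leq_trans (bound_nlogn (size_cover _)) _.
  by rewrite leq_mul2l leq_exp2r // leq_pmulr.
apply: (pc_guesses hM hU hK) => //.
(* The bound on the number of guesses follows from the one on states, since 2^s <= (s+1)^(s+1); the
   case s = 0 is separate because the base is then 1. *)
apply: pb_le bU _ => x _; case: (size _) => // k.
apply: (@leq_trans (2 ^ k.+2)); first by rewrite leq_exp2l.
by rewrite leq_exp2r.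
Qed.

Theorem theorem1 :
  solvable_in_time code_lds lds
    (fun x => nlogn (vc (lds_graph x)))
    (fun x => nverts (lds_graph x))
  /\
  solvable_in_time code_tc tc
    (fun x => nlogn (items x))
    (fun x => items x + size (tests x)).
Proof.
split; [exact: locating_dominating_solvable | exact: test_cover_solvable].
Qed.
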